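(* Let $n,k\ge1$ be integers and let $W=(w_{ij})_{1\le i,j\le n}$ be an $n\times n$ real symmetric random matrix with the invariance property that $UWU^{\mathrm t}$ has the same distribution as $W$ for any real orthogonal $n\times n$ matrix $U$. For any sequence $\mathbf{i}=(i_1,\dots,i_{2k})$ of elements of $\{1,\dots,n\}$, $$E[w_{i_1i_2}w_{i_3i_4}\cdots w_{i_{2k-1}i_{2k}}]=\sum_{\sigma,\tau\in M_{2k}}\delta'_\sigma(\mathbf{i})\,\mathrm{Wg}^{\mathrm O}(\sigma^{-1}\tau;n)\,E[\mathrm{Tr}'_\tau(W)].$$
   Context: $A^{\mathrm t}$ denotes the transpose of $A$. $S_{2k}$ is the symmetric group on $\{1,\dots,2k\}$, with product $(\sigma\tau)(i)=\sigma(\tau(i))$. For $\sigma\in S_{2k}$, let $\Gamma(\sigma)$ be the undirected (multi)graph with vertices $1,\dots,2k$ and edges $\{2i-1,2i\}$ and $\{\sigma(2i-1),\sigma(2i)\}$ for $i=1,\dots,k$ (edges of the two kinds are distinguished even if they coincide). Its connected components have even sizes $2\mu_1\ge2\mu_2\ge\dots\ge2\mu_l$; the partition $\mu=(\mu_1,\dots,\mu_l)$ of $k$ is the coset-type of $\sigma$, and $\kappa'(\sigma)=l$ is the number of components. $M_{2k}$ is the set of pair partitions of $\{1,\dots,2k\}$. Each is written uniquely as $\{\{\sigma(1),\sigma(2)\},\dots,\{\sigma(2k-1),\sigma(2k)\}\}$ with $1=\sigma(1)<\sigma(3)<\dots<\sigma(2k-1)$ and $\sigma(2i-1)<\sigma(2i)$,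 and is thereby identified with the permutation $\sigma\in S_{2k}$; so $M_{2k}\subset S_{2k}$. For $\sigma\in S_{2k}$ and $\mathbf{i}=(i_1,\dots,i_{2k})$, $\delta'_\sigma(\mathbf{i})=\prod_{s=1}^k\delta_{i_{\sigma(2s-1)},i_{\sigma(2s)}}$ (Kronecker deltas). For a square matrix $A$ and $\sigma\in S_{2k}$ of coset-type $(\mu_1,\dots,\mu_l)$, $\mathrm{Tr}'_\sigma(A)=\prod_{j=1}^l\mathrm{Tr}(A^{\mu_j})$. $H_k\subset S_{2k}$ is the hyperoctahedral group of order $2^kk!$, the centralizer of $(1\ 2)(3\ 4)\cdots(2k-1\ 2k)$. $L(S_{2k},H_k)$ is the space of $H_k$-biinvariant functions $S_{2k}\to\mathbb{C}$, a commutative algebra under $(f_1\sharp f_2)(\sigma)=\sum_{\tau\in M_{2k}}f_1(\sigma\tau)f_2(\tau^{-1})$, with identity the indicator function $\mathbf{1}_{H_k}$. For $z\in\mathbb{C}$, the orthogonal Weingarten function $\mathrm{Wg}^{\mathrm O}(\cdot;z)$ is the unique element of $L(S_{2k},H_k)$ with $z^{\kappa'(\cdot)}\sharp\mathrm{Wg}^{\mathrm O}(\cdot;z)\sharp z^{\kappa'(\cdot)}=z^{\kappa'(\cdot)}$ and $\mathrm{Wg}^{\mathrm O}(\cdot;z)\sharp z^{\kappa'(\cdot)}\sharp\mathrm{Wg}^{\mathrm O}(\cdot;z)=\mathrm{Wg}^{\mathrm O}(\cdot;z)$. Equivalently, $$\mathrm{Wg}^{\mathrm O}(\sigma;z)=\frac{2^kk!}{(2k)!}\sum_{\lambda\vdash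 k,\ C'_\lambda(z)\ne0}\frac{f^{2\lambda}}{C'_\lambda(z)}\omega^\lambda(\sigma),\qquad C'_\lambda(z)=\prod_{i=1}^{\ell(\lambda)}\prod_{j=1}^{\lambda_i}(z+2j-i-1),$$ where $\ell(\lambda)$ is the length of the partition $\lambda$, $\omega^\lambda=(2^kk!)^{-1}\chi^{2\lambda}*\mathbf{1}_{H_k}$ (with $(f_1*f_2)(\pi)=\sum_{\tau\in S_{2k}}f_1(\tau)f_2(\tau^{-1}\pi)$), $2\lambda=(2\lambda_1,2\lambda_2,\dots)$, $\chi^{2\lambda}$ is the irreducible character of $S_{2k}$ indexed by $2\lambda$, and $f^{2\lambda}=\chi^{2\lambda}(e)$ with $e$ the identity permutation. *)

(* Defs.v *)
From HB Require Import structures.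
From mathcomp Require Import all_boot all_order all_algebra all_fingroup.
From mathcomp Require Import complex.
From mathcomp Require Import all_classical all_reals all_analysis.
Set Implicit Arguments.
Unset Strict Implicit.
Unset Printing Implicit Defensive.
Import Order.TTheory GRing.Theory Num.Theory.
Import numFieldNormedType.Exports.
Local Open Scope ring_scope.

(* Points are numbered from 0: for i : 'I_k, [ptl i] and [ptr i] are the points
   written 2i-1 and 2i (1-based i) in the usual numbering 1, ..., 2k. *)
Lemma ptl_subproof (k : nat) (i : 'I_k) : (i.*2 < k.*2)%N.
Proof. by rewrite ltn_double. Qed.

Lemma ptr_subproof (k : nat) (i : 'I_k) : (i.*2.+1 < k.*2)%N.
Proof. by rewrite ltn_Sdouble. Qed.

Definition ptl (k : nat) (i : 'I_k) : 'I_k.*2 := Ordinal (ptl_subproof i).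
Definition ptr (k : nat) (i : 'I_k) : 'I_k.*2 := Ordinal (ptr_subproof i).

(* The product (s t)(i) = s (t i): MathComp's group law on permutations
   composes in the opposite order, (s * t)%g i = t (s i). *)
Definition comp_perm (m : nat) (s t : 'S_m) : 'S_m := (t * s)%g.

(* Adjacency in the multigraph Gamma(s); edge multiplicities do not affect the
   connected components. *)
Definition gamma_adj (k : nat) (s : 'S_k.*2) : rel 'I_k.*2 := fun x y =>
  [exists i : 'I_k, ([set x; y] == [set ptl i; ptr i])
                 || ([set x; y] == [set s (ptl i); s (ptr i)])].

Definition gamma_components (k : nat) (s : 'S_k.*2) : {set {set 'I_k.*2}} :=
  equivalence_partition (connect (gamma_adj s)) [set: 'I_k.*2].

Definition coset_type (k : nat) (s : 'S_k.*2) : seq nat :=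
  sort geq [seq #|B|./2 | B : {set 'I_k.*2} in gamma_components s].

Definition kappa' (k : nat) (s : 'S_k.*2) : nat := #|gamma_components s|.

Definition pair_perms (k : nat) : {set 'S_k.*2} :=
  [set s : 'S_k.*2 |
    [&& [forall i : 'I_k, (i == 0 :> nat) ==> (s (ptl i) == 0 :> nat)],
        [forall i : 'I_k, forall j : 'I_k, (i < j)%N ==> (s (ptl i) < s (ptl j))%N]
      & [forall i : 'I_k, (s (ptl i) < s (ptr i))%N]]].

Definition delta' (k n : nat) (s : 'S_k.*2) (i : 'I_k.*2 -> 'I_n) : nat :=
  (\prod_(r < k) (i (s (ptl r)) == i (s (ptr r))))%N.

Definition Tr' (R : pzRingType) (k n : nat) (s : 'S_k.*2) (A : 'M[R]_n) : R :=
  \prod_(m <- coset_type s) \tr (A ^+ m).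

Definition hyperoctahedral (k : nat) : {set 'S_k.*2} :=
  'C[(\prod_(i < k) tperm (ptl i) (ptr i))%g]%g.

Section OrthogonalWeingarten.
Variables (R : realType) (k : nat).
Local Notation C := R[i].
Implicit Types f g : {ffun 'S_k.*2 -> C}.

Definition biinvariant f : Prop :=
  forall (s h h' : 'S_k.*2), h \in hyperoctahedral k -> h' \in hyperoctahedral k ->
    f (comp_perm h (comp_perm s h')) = f s.

Definition sharp f g : {ffun 'S_k.*2 -> C} :=
  [ffun s => \sum_(t in pair_perms k) f (comp_perm s t) * g t^-1%g].

Definition zkappa (z : C) : {ffun 'S_k.*2 -> C} := [ffun s => z ^+ kappa' s].

Definition is_WgO (z : C) f : Prop :=
  [/\ biinvariant f,
      sharp (sharp (zkappa z) f) (zkappa z) = zkappa z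
    & sharp (sharp f (zkappa z)) f = f].

(* The unique function satisfying [is_WgO z]; the default value 0 of the choice
   operator is never used, since such a function exists for every z. *)
Definition WgO (z : C) : {ffun 'S_k.*2 -> C} :=
  xget [ffun=> 0] [set f | is_WgO z f]%classic.

End OrthogonalWeingarten.

(* Square matrices with the Borel sigma-algebra of their usual topology. *)
Definition borel_mx (R : realType) (n : nat) :=
  g_sigma_algebraType (@open 'M[R]_n).

(* Equality in law of U W U^T and W, for every real orthogonal U. *)
Definition orthogonally_invariant (R : realType) (n : nat)
    (d : measure_display) (T : measurableType d) (P : probability T R)
    (W : T -> 'M[R]_n) : Prop :=
  forall U : 'M[R]_n, U *m U^T = 1%:M ->
  forall B : set (borel_mx R n), measurable B ->
    P ((fun t => U *m W t *m U^T) @^-1` B)%classic = P (W @^-1` B)%classic.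

Definition entry_monomial (R : pzRingType) (k n : nat) (i : 'I_k.*2 -> 'I_n)
    (A : 'M[R]_n) : R :=
  \prod_(r < k) A (i (ptl r)) (i (ptr r)).

(* Main.v *)
(* The moments F(j) = E[w_{j_1 j_2} ... w_{j_{2k-1} j_{2k}}] form a tensor that is
   invariant under O(n) and, W being symmetric, under H_k.  By the first
   fundamental theorem for O(n), F = sum_s c_s delta'_s for some coefficients c.
   Summing F against delta'_t gives E[Tr'_t(W)], which is therefore the image of c
   under the Gram matrix G(s, t) = sum_j delta'_s(j) delta'_t(j) = n^kappa'(s^-1 t).
   The Weingarten function satisfies G Wg G = G, so Wg G c - c lies in the kernel of
   G; a vector in the kernel of a Gram matrix is killed by sum_s v_s delta'_s, and so
   sum_s (Wg G c)_s delta'_s = F.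

   The first fundamental theorem is needed only for H_k-invariant tensors.  Such a
   tensor amounts to a polynomial on symmetric matrices (polarization), and an
   O(n)-invariant polynomial is determined by its values on diagonal matrices
   (spectral theorem), where it is a symmetric function.  The same reduction to
   diagonal matrices evaluates sum_j delta'_t(j) A_{j_1 j_2} ... A_{j_{2k-1} j_{2k}}
   as Tr'_t(A), with no need to follow the cycles of the graph Gamma(t). *)
Require Import Defs.
From HB Require Import structures.
From mathcomp Require Import all_boot all_order all_algebra all_fingroup.
From mathcomp Require Import complex.
From mathcomp Require Import all_classical all_reals all_analysis.
From mathcomp Require Import measurable_realfun zify ring.
Import Order.TTheory GRing.Theory Num.Theory.
Import numFieldNormedType.Exports.
Local Open Scope ring_scope.
Set Implicit Arguments.
Unset Strict Implicit.
Unset Printing Implicit Defensive.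

(** * The points of the pairs *)

Section Points.
Variable k : nat.
Local Notation X := 'I_k.*2.
Implicit Types (i : 'I_k) (x : X).

Lemma pt_half_subproof x : (x./2 < k)%N.
Proof. by rewrite ltn_half_double. Qed.

Definition pt_half x : 'I_k := Ordinal (pt_half_subproof x).

Definition pt (b : bool) i : X := if b then ptr i else ptl i.

Lemma pt_half_ptl i : pt_half (ptl i) = i.
Proof. by apply: val_inj; rewrite /= doubleK. Qed.

Lemma pt_half_ptr i : pt_half (ptr i) = i.
Proof. by apply: val_inj; rewrite /= uphalf_double. Qed.

Lemma ptE x : x = pt (odd x) (pt_half x).
Proof.
by apply: val_inj; rewrite /pt -[LHS](odd_double_half x); case: (odd x).
Qed.

Lemma ptl_inj : injective (@ptl k).
Proof. exact: can_inj pt_half_ptl. Qed.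

Lemma ptr_inj : injective (@ptr k).
Proof. exact: can_inj pt_half_ptr. Qed.

Lemma ptl_neq_ptr i i' : ptl i != ptr i'.
Proof.
apply/eqP => /(congr1 (fun x : X => odd x)) /=.
by rewrite !odd_double.
Qed.

Lemma pt_ind (Q : X -> Prop) :
  (forall i, Q (ptl i)) -> (forall i, Q (ptr i)) -> forall x, Q x.
Proof. by move=> Ql Qr x; rewrite [x]ptE /pt; case: odd. Qed.

Definition pt_swap x : X := pt (~~ odd x) (pt_half x).

Lemma pt_swapl i : pt_swap (ptl i) = ptr i.
Proof. by rewrite /pt_swap pt_half_ptl /= odd_double. Qed.

Lemma pt_swapr i : pt_swap (ptr i) = ptl i.
Proof. by rewrite /pt_swap pt_half_ptr /= odd_double. Qed.

Lemma pt_swapK : involutive pt_swap.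
Proof.
by apply: pt_ind => i; rewrite (pt_swapl, pt_swapr) (pt_swapl, pt_swapr).
Qed.

Lemma big_pt (S : Type) (idx : S) (op : Monoid.com_law idx) (F : X -> S) :
  \big[op/idx]_x F x = \big[op/idx]_i op (F (ptl i)) (F (ptr i)).
Proof.
rewrite big_split /= (bigID (fun x : X => odd x)) /= Monoid.mulmC.
congr (op _ _).
- rewrite (reindex_onto (@ptl k) pt_half) /=.
    by apply: eq_bigl => i; rewrite pt_half_ptl eqxx odd_double.
  by move=> x /negbTE ox; rewrite [RHS]ptE ox.
- rewrite (reindex_onto (@ptr k) pt_half) /=.
    by apply: eq_bigl => i; rewrite pt_half_ptr eqxx odd_double.
  by move=> x ox; rewrite [RHS]ptE ox.
Qed.

(** The transpositions are disjoint, so a point is moved only by the factor of its own pair.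
    Membership in the centralizer thus becomes commutation with [pt_swap]. *)
Lemma prod_tpermE x :
  (\prod_(i < k) tperm (ptl i) (ptr i))%g x = pt_swap x.
Proof.
have nmem (r : seq 'I_k) y : pt_half y \notin r ->
    (\prod_(i <- r) tperm (ptl i) (ptr i))%g y = y.
  elim: r y => [|i r IHr] y; first by rewrite big_nil perm1.
  rewrite inE negb_or big_cons permM => /andP[yi yr].
  by rewrite tpermD ?IHr //; apply: contraNneq yi => <-;
    rewrite ?pt_half_ptl ?pt_half_ptr.
have mem (r : seq 'I_k) y : uniq r -> pt_half y \in r ->
    (\prod_(i <- r) tperm (ptl i) (ptr i))%g y = pt_swap y.
  elim: r y => [|i r IHr] y //=; rewrite inE big_cons permM => /andP[ir ur].
  have [yi _|yi /= yr] := eqVneq (pt_half y) i.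
    rewrite [y]ptE yi /pt; case: odd.
      by rewrite tpermR pt_swapr nmem ?pt_half_ptl.
    by rewrite tpermL pt_swapl nmem ?pt_half_ptr.
  by rewrite tpermD ?IHr //; apply: contraNneq yi => <-;
    rewrite ?pt_half_ptl ?pt_half_ptr.
by rewrite mem ?index_enum_uniq ?mem_index_enum.
Qed.

Lemma hyperoctahedralP (h : 'S_k.*2) :
  reflect (forall x, h (pt_swap x) = pt_swap (h x)) (h \in hyperoctahedral k).
Proof.
apply: (iffP cent1P) => [hC x | hC].
  by rewrite -!prod_tpermE -!permM hC.
by apply/permP => x; rewrite !permM !prod_tpermE hC.
Qed.

(** The wreath product action: [p] permutes the pairs and [b] tells which ones get flipped. *)
Definition pt_act (b : {ffun 'I_k -> bool}) (p : 'S_k) x : X :=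
  pt (odd x (+) b (pt_half x)) (p (pt_half x)).

Lemma pt_actl b p i : pt_act b p (ptl i) = pt (b i) (p i).
Proof. by rewrite /pt_act pt_half_ptl /= odd_double. Qed.

Lemma pt_actr b p i : pt_act b p (ptr i) = pt (~~ b i) (p i).
Proof. by rewrite /pt_act pt_half_ptr /= odd_double. Qed.

Lemma pt_act_inj b p : injective (pt_act b p).
Proof.
have half_pt c i : pt_half (pt c i) = i.
  by case: c; rewrite ?pt_half_ptl ?pt_half_ptr.
have odd_pt c i : odd (pt c i) = c by case: c; rewrite /= odd_double.
move=> x y exy; have /perm_inj ehalf : p (pt_half x) = p (pt_half y).
  by have := congr1 pt_half exy; rewrite !half_pt.
rewrite [x]ptE [y]ptE -ehalf; congr (pt _ _).
have := congr1 (fun z : X => odd z) exy.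
by rewrite !odd_pt ehalf => /addIb.
Qed.

Definition pt_perm b p : 'S_k.*2 := perm (@pt_act_inj b p).

Lemma pt_swap_pt c i : pt_swap (pt c i) = pt (~~ c) i.
Proof. by case: c; rewrite ?pt_swapl ?pt_swapr. Qed.

Lemma pt_perm_hyperoctahedral b p : pt_perm b p \in hyperoctahedral k.
Proof.
apply/hyperoctahedralP; apply: pt_ind => i; rewrite !permE.
  by rewrite pt_swapl pt_actl pt_actr pt_swap_pt.
by rewrite pt_swapr pt_actl pt_actr pt_swap_pt negbK.
Qed.

End Points.

(** * Pair partitions as a transversal of the cosets of the hyperoctahedral group *)

Section Transversal.
Variable k : nat.
Local Notation X := 'I_k.*2.
Local Notation H := (hyperoctahedral k).
Implicit Types (s h : 'S_k.*2).

Canonical hyperoctahedral_group := [group of H].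

(** No right point is sent to 0, since its left partner would have to go below; among left points
    monotonicity allows only the first, which settles the normalization. *)
Lemma pair_permsP s :
  reflect ((forall i j : 'I_k, (i < j)%N -> (s (ptl i) < s (ptl j))%N) /\
           (forall i : 'I_k, (s (ptl i) < s (ptr i))%N))
          (s \in pair_perms k).
Proof.
rewrite inE; apply: (iffP and3P) => [[_ s_inc s_lr]|[s_inc s_lr]]; split.
- by move=> i j; apply/implyP; move/forallP: s_inc => /(_ i)/forallP.
- exact/forallP.
- apply/forallP => i; apply/implyP => /eqP i0.
  have k0 : (0 < k.*2)%N by rewrite double_gt0 -(ltn_predK (ltn_ord i)).
  have [y sy] : exists y, s y = Ordinal k0 by exists (s^-1%g (Ordinal k0)); rewrite permKV.
  have: s y = 0 :> nat by rewrite sy.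
  elim/pt_ind: y {sy} => j sj; last by have := s_lr j; rewrite sj.
  have [ij|ji|/val_inj -> //] := ltngtP i j; last by rewrite sj.
    by have := s_inc _ _ ij; rewrite sj.
  by rewrite i0 in ji.
- apply/forallP => i; apply/forallP => j; apply/implyP; exact: s_inc.
- exact/forallP.
Qed.

(* The pairs and their two points get sorted by minimizing a weighted sum of the
   left points: swapping a wrongly ordered couple strictly decreases it. *)
Lemma pair_perms_ex s : exists2 h, h \in H & (h * s)%g \in pair_perms k.
Proof.
(* The weights [k - r] are positive, so unflipping a pair lowers the sum, and strictly decreasing in
   [r], so exchanging two pairs in the wrong order lowers it. *)
pose w h := (\sum_(r < k) (k - r) * s (h (ptl r)))%N.
have [h hH hmin] := @arg_minnP _ 1%g (mem H) w (group1 _).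
exists h => //.
have actH b p : (pt_perm b p * h)%g \in H by rewrite groupM ?pt_perm_hyperoctahedral.
apply/pair_permsP; split=> [i j ij | i]; rewrite !permM.
- rewrite ltnNge; apply/negP; rewrite leq_eqVlt => /predU1P[|ltji].
    by move/val_inj/perm_inj/perm_inj/ptl_inj => ji; rewrite ji ltnn in ij.
  have := hmin _ (actH [ffun=> false] (tperm i j)).
  have ij' : j != i by apply: contraTneq ij => ->; rewrite ltnn.
  rewrite /w (bigD1 i) // (bigD1 j) //= [X in (_ <= X)%N](bigD1 i) //.
  rewrite [X in (_ <= _ + X)%N](bigD1 j) //= !permM !permE !pt_actl !ffunE tpermL tpermR /=.
  under [X in (_ <= _ + (_ + X))%N]eq_bigr => r /andP[ri rj].
    rewrite !permM permE pt_actl ffunE tpermD 1?eq_sym //=; over.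
  have := ltn_ord j; move: ij ltji.
  move: (s (h (ptl i)) : nat) (s (h (ptl j)) : nat) (\sum_(r < k | _) _)%N => a c t.
  move: (i : nat) (j : nat) => i' j'; clear => ij ca jk.
  rewrite !addnA leq_add2r leqNgt => /negP[].
  nia.
- rewrite ltnNge; apply/negP; rewrite leq_eqVlt => /predU1P[|ltri].
    move/val_inj/perm_inj/perm_inj => e; have := ptl_neq_ptr i i.
    by rewrite e eqxx.
  have := hmin _ (actH [ffun r => r == i] 1%g).
  rewrite /w (bigD1 i) //= [X in (_ <= X)%N](bigD1 i) //=.
  rewrite !permM !permE !pt_actl !ffunE eqxx perm1 /=.
  under [X in (_ <= _ + X)%N]eq_bigr => r ri.
    rewrite !permM permE pt_actl ffunE perm1 (negPf ri) /=; over.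
  rewrite leq_add2r leqNgt => /negP[].
  by rewrite ltn_mul2l ltri subn_gt0 ltn_ord.
Qed.

(** Both permutations send left points below their right partners, so [h] flips no pair. It permutes
    the pairs monotonically, and an increasing self-map of ['I_k] is the identity. *)
Lemma pair_perms_uniq s h :
  h \in H -> s \in pair_perms k -> (h * s)%g \in pair_perms k -> h = 1%g.
Proof.
move=> /hyperoctahedralP hH /pair_permsP[s_inc s_lr] /pair_permsP[hs_inc hs_lr].
have hl (i : 'I_k) : h (ptl i) = ptl (pt_half (h (ptl i))).
  have := hs_lr i; rewrite !permM -(pt_swapl i) hH.
  elim/pt_ind: (h (ptl i)) => j; first by rewrite pt_half_ptl.
  by rewrite pt_swapr ltnNge ltnW.
pose p i := pt_half (h (ptl i)).
have s_mono (i j : 'I_k) : (s (ptl i) < s (ptl j))%N -> (i < j)%N.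
  have [//|/s_inc ji|/val_inj->] := ltngtP i j; last by rewrite ltnn.
  by rewrite ltnNge ltnW.
have p_mono (i j : 'I_k) : (i < j)%N -> (p i < p j)%N.
  by move=> /hs_inc; rewrite !permM hl (hl j) => /s_mono.
have p_ge (i : 'I_k) : (i <= p i)%N.
  case: i => m; elim: m => // m IHm mk.
  by apply: leq_ltn_trans (IHm (ltnW mk)) (p_mono _ _ _).
have p_le (i : 'I_k) : (p i <= i)%N.
  case: i => m mk; have: (k - m.+1 + m.+1 = k)%N by rewrite subnK.
  move: (k - m.+1)%N => e; elim: e m mk => [|e IHe] m mk ke.
    by rewrite -ltnS [X in (_ < X)%N]ke ltn_ord.
  have m1k : (m.+1 < k)%N by rewrite -ke addSn ltnS leq_addl.
  have := leq_trans (p_mono (Ordinal mk) (Ordinal m1k) (ltnSn _)) (IHe _ m1k _).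
  by rewrite /= ltnS; apply; rewrite -ke addnS.
have pE i : p i = i by apply/val_inj/eqP; rewrite eqn_leq p_le p_ge.
apply/permP; apply: pt_ind => i; rewrite perm1.
  by rewrite hl -[pt_half _]/(p i) pE.
by rewrite -(pt_swapl i) hH hl -[pt_half _]/(p i) pE.
Qed.

(** Every [s] has exactly one [h] in [H] with [(h * s)%g] in [pair_perms k]. *)
Lemma sum_pair_perms (V : nmodType) (f : 'S_k.*2 -> V) :
  (forall h s, h \in H -> f (h * s)%g = f s) ->
  \sum_s f s = (\sum_(s in pair_perms k) f s) *+ #|H|.
Proof.
move=> fH.
have one s : \sum_(h in H | (h * s)%g \in pair_perms k) f s = f s.
  have [h hH hs] := pair_perms_ex s.
  rewrite (big_pred1 h) // => g; apply/andP/eqP => [[gH gs]|-> //].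
  have := @pair_perms_uniq (h * s)%g (g * h^-1)%g.
  rewrite groupM ?groupV // hs mulgA mulgKV => /(_ isT isT gs) /eqP.
  by rewrite -eq_mulgV1 => /eqP.
under eq_bigr do rewrite -one.
rewrite (exchange_big_dep (mem H)) /=; last by move=> s h _ /andP[].
rewrite -sumr_const; apply: eq_bigr => h hH.
rewrite (reindex_inj (mulgI h^-1)%g) /=; apply: eq_big => [s|s _].
  by rewrite hH mulKVg.
by rewrite fH ?groupV.
Qed.

End Transversal.

(** * Deltas and the graph of a permutation *)

(** Expanding the product over the blocks chooses one value per block, that is, a function constant
    on blocks. *)
Lemma sum_block_constant (A : comPzSemiRingType) (T I : finType) (a0 : I)
    (P : {set {set T}}) (g : T -> I -> A) : finset.partition P [set: T]%SET ->
  \sum_(j : {ffun T -> I} | [forall x, forall y in finset.pblock P x, j y == j x])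
     \prod_x g x (j x) =
  \prod_(B in P) \sum_a \prod_(x in B) g x a.
Proof.
move=> partP; have [/eqP covP trivP P0] := and3P partP.
have inP x : finset.pblock P x \in P by rewrite pblock_mem // covP.
have inB x : x \in finset.pblock P x by rewrite mem_pblock covP.
rewrite (big_distr_big_dep a0).
(* The inverse of the reindexing reads [j] at some point of each block; [a0] is the default on sets
   outside [P]. *)
pose rep (j : {ffun T -> I}) (B : {set T}) := odflt a0 (omap j [pick x in B]).
pose phi (j : {ffun T -> I}) := [ffun B => if B \in P then rep j B else a0].
rewrite (reindex_onto (fun f : {ffun {set T} -> I} => [ffun x => f (finset.pblock P x)]) phi) /=;
  last first.
  move=> j /forallP jP; apply/ffunP => x; rewrite !ffunE inP /rep.
  case: pickP => [y yx|/(_ x)] /=; last by rewrite inB.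
  by have /forall_inP/(_ _ yx)/eqP := jP x.
apply: eq_big => [f | f _].
- apply/andP/pfamilyP => [[_ /eqP <-]|[fsupp _]].
    split=> [|B]; last by [].
    by apply/fintype.subsetP => B; rewrite inE ffunE; case: ifP => // _; rewrite eqxx.
  split.
    apply/forallP => x; apply/forall_inP => y yx; rewrite !ffunE.
    by rewrite (same_pblock trivP yx).
  apply/eqP/ffunP => B; rewrite ffunE; case: ifPn => [BP|BnP]; last first.
    by apply/esym/eqP; apply: contraNT BnP => fB; apply: (fintype.subsetP fsupp).
  rewrite /rep; case: pickP => [x xB|B0] /=; first by rewrite ffunE (def_pblock trivP BP xB).
  by case/negP: P0; rewrite (_ : finset.set0 = B) //; apply/setP => x; rewrite inE B0.
- rewrite (eq_bigl (mem (finset.cover P))) => [|x]; last by rewrite inE /= covP inE.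
  rewrite finset.big_trivIset //; apply: eq_bigr => B BP; apply: eq_bigr => x xB.
  by rewrite ffunE (def_pblock trivP BP xB).
Qed.

Section Delta.
Variables (k n : nat).
Local Notation X := 'I_k.*2.
Local Notation H := (hyperoctahedral k).
Implicit Types (s t h : 'S_k.*2) (j : X -> 'I_n).

Lemma delta'E s j :
  delta' s j = [forall i : 'I_k, j (s (ptl i)) == j (s (ptr i))].
Proof.
rewrite /delta' -(big_morph nat_of_bool (fun a b => esym (mulnb a b))
  (erefl : nat_of_bool true = 1%N)).
by rewrite big_andE.
Qed.

Lemma delta'_swap s j : delta' s j = [forall x, j (s (pt_swap x)) == j (s x)].
Proof.
rewrite delta'E; congr nat_of_bool; apply/forallP/forallP => jP => [|i].
  by apply: pt_ind => i; rewrite (pt_swapl, pt_swapr) // eq_sym.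
by rewrite -[ptl i]pt_swapr.
Qed.

Lemma delta'_mulHl h s j : h \in H -> delta' (h * s)%g j = delta' s j.
Proof.
move=> hH; rewrite !delta'_swap; congr nat_of_bool.
apply/forallP/forallP => jP x; last by rewrite !permM (hyperoctahedralP _ hH); apply: jP.
by have := jP (h^-1 x)%g; rewrite !permM (hyperoctahedralP _ hH) permKV.
Qed.

Lemma delta'_mul s t j : delta' (s * t)%g j = delta' s (j \o t).
Proof. by rewrite /delta'; apply: eq_bigr => i _; rewrite /= !permM. Qed.

Lemma entry_monomial_diag (A : comPzRingType) (D : 'rV[A]_n) j :
  entry_monomial j (diag_mx D) =
  (delta' 1 j)%:R * \prod_i D 0 (j (ptl i)).
Proof.
rewrite delta'E /entry_monomial; case: (altP forallP) => [jP | ].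
  rewrite mul1r; apply: eq_bigr => i _; rewrite mxE.
  by have := jP i; rewrite !perm1 => ->; rewrite mulr1n.
rewrite negb_forall => /existsP[i ji]; rewrite mul0r (bigD1 i) //= mxE.
by rewrite !perm1 in ji; rewrite (negPf ji) mul0r.
Qed.

Lemma gamma_adj_sym s : symmetric (gamma_adj s).
Proof. by move=> x y; rewrite /gamma_adj; apply: eq_existsb => i; rewrite [in LHS]finset.setUC. Qed.

Lemma gamma_equivalence s :
  {in [set: X]%SET & &, equivalence_rel (connect (gamma_adj s))}.
Proof.
move=> x y z _ _ _; split=> [|xy]; first exact: connect0.
exact: same_connect (sym_connect_sym (@gamma_adj_sym s)) _ _ xy z.
Qed.

Lemma gamma_partition s : finset.partition (gamma_components s) [set: X]%SET.
Proof. exact: equivalence_partitionP (@gamma_equivalence s). Qed.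

Lemma gamma_pblock s x y :
  (y \in finset.pblock (gamma_components s) x) = connect (gamma_adj s) x y.
Proof.
by rewrite (pblock_equivalence_partition (@gamma_equivalence s)) ?inE.
Qed.

Lemma gamma_adj_swap s x : gamma_adj s x (pt_swap x).
Proof.
apply/existsP; exists (pt_half x); apply/orP; left.
by elim/pt_ind: x => i; rewrite (pt_swapl, pt_swapr) ?pt_half_ptl ?pt_half_ptr // finset.setUC.
Qed.

Lemma gamma_adj_edge s i : gamma_adj s (s (ptl i)) (s (ptr i)).
Proof. by apply/existsP; exists i; rewrite eqxx orbT. Qed.

Lemma set2_eqP (T : finType) (a b c e : T) :
  [set a; b]%SET == [set c; e]%SET -> (a = c /\ b = e) \/ (a = e /\ b = c).
Proof.
move=> /eqP/setP abce.
have := (abce a, abce b, abce c, abce e); rewrite !inE !eqxx !orbT /=.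
case=> [[[/esym/orP[]/eqP ?]]] /esym/orP[]/eqP ?; subst; rewrite ?eqxx ?orbF ?orbb.
- by move=> _ /eqP ->; left.
- by left.
- by right.
- by move=> /eqP -> _; right.
Qed.

(** The two deltas say that [j] agrees along the two kinds of edges, hence along every path. *)
Lemma delta'_gamma s (j : {ffun X -> 'I_n}) :
  (delta' 1 j * delta' s j)%N =
  [forall x, forall y in finset.pblock (gamma_components s) x, j y == j x].
Proof.
rewrite !delta'E mulnb; congr nat_of_bool.
apply/andP/forallP => [[/forallP j1 /forallP js] x | jP].
  apply/forall_inP => y; rewrite gamma_pblock => xy.
  have clos : fingraph.closed (gamma_adj s) [pred z | j z == j x].
    move=> a b /existsP[i /orP[]/set2_eqP[] [-> ->]]; rewrite !inE.
    - by have := j1 i; rewrite !perm1 => /eqP ->.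
    - by have := j1 i; rewrite !perm1 => /eqP ->.
    - by have := js i; move=> /eqP ->.
    - by have := js i; move=> /eqP ->.
  by have := closed_connect clos xy; rewrite !inE eqxx => <-.
have jadj x y : gamma_adj s x y -> j x == j y.
  by move=> xy; rewrite eq_sym; apply: (forall_inP (jP x)); rewrite gamma_pblock connect1.
split; apply/forallP => i; last by rewrite jadj ?gamma_adj_edge.
by rewrite !perm1 -pt_swapl jadj ?gamma_adj_swap.
Qed.

(** Since [ptl i] and [ptr i] are adjacent, a component is a union of such pairs. *)
Lemma gamma_component_card s B : B \in gamma_components s ->
  #|B|./2 = #|[set i : 'I_k | ptl i \in B]|.
Proof.
move=> BG; have Bswap x : (pt_swap x \in B) = (x \in B).
  suff imp y : y \in B -> pt_swap y \in B by apply/idP/idP => /imp; rewrite ?pt_swapK.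
  have [_ trivG _] := and3P (gamma_partition s).
  move=> yB; rewrite -(def_pblock trivG BG yB) gamma_pblock.
  exact/connect1/gamma_adj_swap.
rewrite -[in LHS]sum1_card big_mkcond big_pt /= -[RHS]sum1_card [in RHS]big_mkcond /=.
rewrite (eq_bigr (fun i => (if ptl i \in B then 1 else 0) * 2)%N); last first.
  by move=> i _; rewrite -pt_swapl Bswap muln2 addnn.
rewrite -big_distrl /= muln2 doubleK.
by apply: eq_bigr => i _; rewrite inE.
Qed.

Lemma diag_mx_exp (A : pzRingType) (D : 'rV[A]_n) m :
  (diag_mx D) ^+ m = diag_mx (\row_a D 0 a ^+ m).
Proof.
elim: m => [|m IHm].
  rewrite expr0; apply/matrixP => a b; rewrite !mxE expr0.
  by [].
rewrite exprS IHm -mulmxE mulmx_diag; congr diag_mx.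
by apply/rowP => a; rewrite !mxE exprS.
Qed.

(** The traces are power sums, and their product over the components expands into a sum over the [j]
    constant on components. By [delta'_gamma] these are the [j] that survive on the right. *)
Lemma Tr'_diag (A : comPzRingType) (a0 : 'I_n) t (D : 'rV[A]_n) :
  Tr' t (diag_mx D) =
  \sum_(j : {ffun X -> 'I_n}) (delta' t j)%:R * entry_monomial j (diag_mx D).
Proof.
rewrite /Tr' (perm_big [seq #|B|./2 | B : {set X} in gamma_components t]) /=; last first.
  by rewrite perm_sort.
rewrite big_map big_enum /=.
(* The weight sits on left points only, so that each pair contributes its diagonal entry once. *)
pose g (x : X) a := if odd x then 1 else D 0 a.
transitivity (\prod_(B in gamma_components t) \sum_a \prod_(x in B) g x a).
  apply: eq_bigr => B BG; rewrite diag_mx_exp mxtrace_diag.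
  apply: eq_bigr => a _; rewrite mxE (gamma_component_card BG) -prodr_const.
  rewrite [RHS]big_mkcond big_pt /= [LHS]big_mkcond /=; apply: eq_bigr => i _.
  by rewrite /g /= odd_double /= inE if_same mulr1.
rewrite -(sum_block_constant a0 _ (gamma_partition t)).
rewrite [RHS](bigID (fun j : {ffun X -> 'I_n} =>
  [forall x, forall y in finset.pblock (gamma_components t) x, j y == j x])) /=.
rewrite [X in _ = _ + X]big1 ?addr0 => [|j /negPf jP]; last first.
  by rewrite entry_monomial_diag mulrA -natrM mulnC delta'_gamma jP mul0r.
apply: eq_bigr => j jP.
rewrite entry_monomial_diag mulrA -natrM mulnC delta'_gamma jP mul1r.
by rewrite big_pt; apply: eq_bigr => i _; rewrite /g /= odd_double /= mulr1.
Qed.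
End Delta.

(** * Diagonalization of real symmetric matrices *)

Section RealSpectral.
Variable R : rcfType.

(** Over [R[i]] the matrix is Hermitian, so its spectrum is real and an eigenvalue descends to [R];
    the eigenvector found there is then normalized. *)
Lemma symmetric_eigenvector m (A : 'M[R]_m.+1) : A^T = A ->
  exists v : 'rV_m.+1, exists a, v *m A = a *: v /\ v *m v^T = 1%:M.
Proof.
move=> Asym; pose f := real_complex R; pose Ac := map_mx f A.
have Aherm : Ac \is hermsymmx.
  apply: realsym_hermsym.
    by apply/is_hermitianmxP; rewrite expr0 scale1r map_mx_id // map_trmx Asym.
  by apply/mxOverP => i j; rewrite mxE complex_real.
have /orthomx_spectralP AcE := hermitian_normalmx Aherm.
have /mxOverP/(_ 0 0)/complex_realP[a da] := hermitian_spectral_diag_real Aherm.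
set V := spectralmx Ac in AcE; have Vunit : V \in unitmx := spectral_unit Ac.
have /eigenvalueP[v vA v0] : eigenvalue A a.
  suff: eigenvalue Ac (spectral_diag Ac 0 0) by rewrite da eigenvalue_map.
  apply/eigenvalueP.
  exists (row 0 V).
    rewrite {1}AcE -row_mul !mulmxA mulmxV // mul1mx row_mul row_diag_mx.
    by rewrite -scalemxAl -rowE.
  apply: contraTneq Vunit => V0; rewrite unitmxE unitfE negbK.
  apply/eqP; rewrite (expand_det_row _ 0) big1 // => j _.
  by move/rowP/(_ j): V0; rewrite !mxE => ->; rewrite mul0r.
pose q := \sum_j v 0 j ^+ 2.
have q0 : 0 < q.
  have [j vj] : exists j, v 0 j != 0 by apply/rV0Pn.
  rewrite /q (bigD1 j) //= ltr_pwDl ?exprn_even_gt0 //.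
  by apply: sumr_ge0 => i _; exact: sqr_ge0.
exists ((Num.sqrt q)^-1 *: v), a; split; first by rewrite -scalemxAl vA !scalerA mulrC.
apply/matrixP => i j; rewrite !ord1 !mxE /=.
under eq_bigr do rewrite !mxE mulrACA -expr2.
rewrite -mulr_sumr exprVn sqr_sqrtr ?ltW // -/q.
by rewrite mulVf // gt_eqF.
Qed.

(** Unless [v] is the first basis vector [e], take the reflection in the hyperplane orthogonal to
    [v - e]: it exchanges the unit vectors [e] and [v]. *)
Lemma householder m (v : 'rV[R]_m.+1) : v *m v^T = 1%:M ->
  exists Q : 'M[R]_m.+1, [/\ Q^T = Q, Q *m Q = 1%:M & delta_mx 0 0 *m Q = v].
Proof.
move=> v1; pose e : 'rV[R]_m.+1 := delta_mx 0 0.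
have [->|ve] := eqVneq v e; first by exists 1%:M; rewrite trmx1 !mulmx1.
have [w wE] : exists w, w = v - e by exists (v - e).
pose c := (w *m w^T) 0 0.
have cE : w *m w^T = c%:M by rewrite [LHS]mx11_scalar.
have ee : e *m e^T = 1%:M.
  by apply/matrixP => i j; rewrite !ord1 trmx_delta mul_delta_mx !mxE eqxx.
pose t := v 0 0.
have ev : e *m v^T = t%:M.
  by rewrite [LHS]mx11_scalar -rowE !mxE.
have ve' : v *m e^T = t%:M by rewrite -[LHS]trmxK trmx_mul trmxK ev tr_scalar_mx.
have cE' : c = 2 * (1 - t).
  rewrite /c wE linearB /= mulmxBl !mulmxBr v1 ee ev ve' !mxE eqxx !mulr1n.
  ring.
have c0 : c != 0.
  apply: contra_neq ve => c0; apply/eqP; rewrite -subr_eq0; apply/eqP/rowP => j.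
  have cw : c = \sum_j w 0 j ^+ 2.
    by rewrite /c mxE; apply: eq_bigr => i _; rewrite [w^T _ _]mxE expr2.
  have : \sum_j w 0 j ^+ 2 == 0 by rewrite -cw c0.
  rewrite psumr_eq0 => [|i _]; last exact: sqr_ge0.
  by move=> /allP/(_ j); rewrite -wE mem_index_enum sqrf_eq0 [in RHS]mxE => /(_ isT)/eqP.
exists (1%:M - (2 / c) *: (w^T *m w)); split.
- by rewrite linearB linearZ /= trmx1 trmx_mul trmxK.
- rewrite mulmxBl mul1mx mulmxBr mulmx1 -scalemxAl -!scalemxAr scalerA.
  rewrite -mulmxA [w *m _]mulmxA cE mul_scalar_mx -!scalemxAr scalerA.
  rewrite -[RHS]subr0 -addrA -opprD; congr (_ - _).
  rewrite -scaleNr -!scalerDl; apply/eqP; rewrite scaler_eq0; apply/orP; left.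
  by apply/eqP; field.
- rewrite -/e mulmxBr mulmx1 -scalemxAr mulmxA.
  have -> : e *m w^T = (t - 1)%:M by rewrite wE linearB /= mulmxBr ev ee -raddfB.
  rewrite mul_scalar_mx scalerA (_ : 2 / c * (t - 1) = -1).
    by rewrite scaleN1r opprK wE addrC subrK.
  by move: c0; rewrite cE' => c0; field; move: c0; rewrite mulf_eq0 negb_or => /andP[].
Qed.

(** A reflection [Q] exchanges a unit eigenvector with the first basis vector. Then [Q *m A *m Q]
    has first row [(a, 0, ..., 0)], by symmetry also such a first column, and induction applies to
    the remaining block. *)
Lemma symmetric_diagonalization n (A : 'M[R]_n) : A^T = A ->
  exists (U : 'M[R]_n) (D : 'rV[R]_n), U *m U^T = 1%:M /\ A = U *m diag_mx D *m U^T.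
Proof.
elim: n A => [|m IHm] A Asym.
  by exists 1%:M, 0; rewrite trmx1 mulmx1; split => //; apply/matrixP => - [].
have [v [a [vA v1]]] := symmetric_eigenvector Asym.
have [Q [QT QQ eQ]] := householder v1.
pose B : 'M[R]_(1 + m) := Q *m A *m Q.
have BT : B^T = B by rewrite /B !trmx_mul QT Asym mulmxA.
have B0 j : B 0 j = a *+ (j == 0).
  transitivity ((delta_mx 0 0 *m B : 'rV[R]_m.+1) 0 j).
    by rewrite -rowE [RHS]mxE.
  rewrite /B !mulmxA eQ vA -scalemxAl -eQ -mulmxA QQ mulmx1 !mxE eqxx /=.
  by rewrite mulr_natr.
have l0 : lshift m (0 : 'I_1) = 0 :> 'I_(1 + m) by exact: val_inj.
have r0 j : (rshift 1 j == 0 :> 'I_(1 + m)) = false by rewrite -l0 eq_rlshift.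
have BE : B = block_mx a%:M 0 0 (drsubmx B).
  rewrite -[LHS]submxK; congr block_mx; apply/matrixP => i j.
  - by rewrite !ord1 [LHS]mxE [LHS]mxE l0 B0 [RHS]mxE.
  - by rewrite !ord1 [LHS]mxE [LHS]mxE l0 B0 [RHS]mxE r0.
  - by rewrite !ord1 [LHS]mxE [LHS]mxE -BT [LHS]mxE l0 B0 [RHS]mxE r0.
have [U [D [UU DE]]] : exists (U : 'M[R]_m) (D : 'rV[R]_m),
    U *m U^T = 1%:M /\ drsubmx B = U *m diag_mx D *m U^T.
  by apply: IHm; rewrite trmx_drsub BT.
pose V : 'M[R]_(1 + m) := block_mx 1%:M 0 0 U.
have VV : V *m V^T = 1%:M.
  rewrite /V tr_block_mx mulmx_block !trmx0 !trmx1 !mulmx0 !mul0mx mulmx1 !addr0 !add0r UU.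
  by rewrite -scalar_mx_block.
have VD : V *m diag_mx (row_mx a%:M D) *m V^T = B.
  rewrite BE DE /V diag_mx_row tr_block_mx !mulmx_block !trmx0 !trmx1.
  rewrite !(mulmx0, mul0mx, mulmx1, mul1mx, addr0, add0r).
  by congr block_mx; apply/matrixP => i j; rewrite !ord1 !mxE eqxx.
exists (Q *m V), (row_mx a%:M D); split.
  by rewrite trmx_mul QT mulmxA -[Q *m V *m _]mulmxA VV mulmx1.
transitivity (Q *m B *m Q).
  by rewrite /B !mulmxA QQ mul1mx -mulmxA QQ mulmx1.
by rewrite -VD trmx_mul QT !mulmxA.
Qed.
End RealSpectral.

(** * Invariance under orthogonal conjugation *)

Lemma sum_pt_pairs (A : comPzSemiRingType) (k : nat) (I : finType)
    (g : 'I_k -> I -> I -> A) :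
  \sum_(j : {ffun 'I_k.*2 -> I}) \prod_r g r (j (ptl r)) (j (ptr r)) =
  \prod_r \sum_a \sum_b g r a b.
Proof.
under [RHS]eq_bigr do rewrite pair_big /=.
rewrite bigA_distr_bigA /=.
pose split (j : {ffun 'I_k.*2 -> I}) := [ffun r => (j (ptl r), j (ptr r))].
pose join (f : {ffun 'I_k -> I * I}) :=
  [ffun x : 'I_k.*2 => (if odd x then snd else fst) (f (pt_half x))].
have joinl f r : join f (ptl r) = (f r).1 by rewrite ffunE pt_half_ptl /= odd_double.
have joinr f r : join f (ptr r) = (f r).2 by rewrite ffunE pt_half_ptr /= odd_double.
rewrite (reindex join); last first.
  exists split => [f _ | j _].
    by apply/ffunP => r; rewrite ffunE joinl joinr -surjective_pairing.
  by apply/ffunP; apply: pt_ind => i; rewrite (joinl, joinr) ffunE.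
by apply: eq_bigr => f _; apply: eq_bigr => r _; rewrite joinl joinr.
Qed.

Section Tensors.
Variables (A : comPzRingType) (k n : nat).
Local Notation X := 'I_k.*2.
Implicit Types (s t : 'S_k.*2) (j : {ffun X -> 'I_n}) (U M : 'M[A]_n).

Lemma entry_monomial_conj U M (j : X -> 'I_n) :
  entry_monomial j (U *m M *m U^T) =
  \sum_(j' : {ffun X -> 'I_n}) (\prod_x U (j x) (j' x)) * entry_monomial j' M.
Proof.
rewrite /entry_monomial.
pose g r a b := U (j (ptl r)) a * U (j (ptr r)) b * M a b.
rewrite (eq_bigr (fun j' : {ffun X -> 'I_n} => \prod_r g r (j' (ptl r)) (j' (ptr r)))).
  rewrite sum_pt_pairs; apply: eq_bigr => r _.
  rewrite mxE exchange_big /=; apply: eq_bigr => b _.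
  rewrite !mxE big_distrl /=; apply: eq_bigr => a _.
  by rewrite /g mulrAC.
by move=> j' _; rewrite big_pt -big_split.
Qed.

Lemma entry_monomial1 (j : X -> 'I_n) :
  entry_monomial j (1%:M : 'M[A]_n) = (delta' 1 j)%:R.
Proof.
by rewrite -diag_const_mx entry_monomial_diag big1 ?mulr1 // => r _; rewrite mxE.
Qed.

Definition ffun_comp (T I : finType) (s : {perm T}) (j : {ffun T -> I}) := [ffun x => j (s x)].

Lemma ffun_comp_bij (T I : finType) (s : {perm T}) : bijective (@ffun_comp T I s).
Proof.
exists (@ffun_comp T I s^-1%g) => j; apply/ffunP => x; rewrite !ffunE.
  by rewrite permKV.
by rewrite permK.
Qed.

Lemma delta'_ffun_comp s t j : delta' s (ffun_comp t j) = delta' (s * t)%g j.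
Proof. by rewrite delta'_mul; apply: eq_bigr => r _; rewrite !ffunE. Qed.

(** For [t = 1] this expands the entries of [U^T *m 1%:M *m U], which is the identity; the general
    case relabels the points by [t]. *)
Lemma delta'_orthogonal U t (j' : X -> 'I_n) : U^T *m U = 1%:M ->
  \sum_(j : {ffun X -> 'I_n}) (\prod_x U (j x) (j' x)) * (delta' t j)%:R = (delta' t j')%:R.
Proof.
move=> UU; rewrite -{2}[t]mul1g delta'_mul -entry_monomial1.
have -> : 1%:M = U^T *m 1%:M *m U^T^T by rewrite trmxK mulmx1.
rewrite entry_monomial_conj.
rewrite (reindex (ffun_comp t^-1)) /=; last exact/onW_bij/ffun_comp_bij.
apply: eq_bigr => j _; rewrite delta'_ffun_comp mulgV entry_monomial1; congr (_ * _).
rewrite (reindex_inj (@perm_inj _ t)) /=; apply: eq_bigr => x _.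
by rewrite !ffunE permK mxE.
Qed.

Lemma exprmx_conj U M m : U^T *m U = 1%:M ->
  U *m U^T = 1%:M -> (U *m M *m U^T) ^+ m = U *m (M ^+ m) *m U^T.
Proof.
move=> UU UU'; elim: m => [|m IHm]; first by rewrite !expr0 mulmx1 UU'.
by rewrite !exprS IHm -!mulmxE !mulmxA -[_ *m U^T *m U]mulmxA UU mulmx1.
Qed.

Lemma Tr'_conj U M t : U *m U^T = 1%:M -> U^T *m U = 1%:M ->
  Tr' t (U *m M *m U^T) = Tr' t M.
Proof.
move=> UU UU'; apply: eq_bigr => m _.
by rewrite exprmx_conj // mxtrace_mulC mulmxA UU' mul1mx.
Qed.

Lemma Tr'_1 t : Tr' t (1%:M : 'M[A]_n) = n%:R ^+ kappa' t.
Proof.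
rewrite /Tr' (eq_bigr (fun=> n%:R)) => [|m _]; last by rewrite expr1n mxtrace1.
rewrite big_const_seq count_predT size_sort size_map -cardE.
by rewrite -Monoid.iteropE.
Qed.

(** [Tr'] at the identity matrix is evaluated twice: directly, each component gives a factor [n]; by
    [Tr'_diag] it is a sum over [j], brought to the stated form by composing [j] with [s]. *)
Lemma gram_kappa' (a0 : 'I_n) s t :
  \sum_(j : {ffun X -> 'I_n}) (delta' s j)%:R * (delta' t j)%:R =
  n%:R ^+ kappa' (comp_perm s^-1 t)%g :> A.
Proof.
rewrite -Tr'_1 -diag_const_mx (Tr'_diag a0) diag_const_mx.
rewrite [RHS](reindex (ffun_comp s)) /=; last exact/onW_bij/ffun_comp_bij.
apply: eq_bigr => j _; rewrite entry_monomial1 mulrC !delta'_ffun_comp.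
by rewrite mul1g /comp_perm mulgKV.
Qed.
End Tensors.

(** Both sides are unchanged by orthogonal conjugation, the right one by [delta'_orthogonal], so the
    diagonal case suffices. *)
Lemma Tr'_symmetric (R : rcfType) (k n : nat) (a0 : 'I_n) (t : 'S_k.*2) (M : 'M[R]_n) :
  M^T = M ->
  Tr' t M = \sum_(j : {ffun 'I_k.*2 -> 'I_n}) (delta' t j)%:R * entry_monomial j M.
Proof.
move=> /symmetric_diagonalization[U [D [UU ->]]]; have UU' := mulmx1C UU.
rewrite Tr'_conj // (Tr'_diag a0).
under [RHS]eq_bigr do rewrite entry_monomial_conj big_distrr /=.
rewrite exchange_big /=; apply: eq_bigr => j' _.
rewrite -(delta'_orthogonal _ _ UU') big_distrl /=; apply: eq_bigr => j _.
by rewrite mulrA [_%:R * _]mulrC.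
Qed.

(** * Existence of the Weingarten function *)

Section PseudoInverse.
Variables (F : fieldType).

Lemma ex_generalized_inverse (T : finType) (a : T -> T -> F) :
  exists b : T -> T -> F, forall x y,
    \sum_u \sum_v a x u * b u v * a v y = a x y.
Proof.
pose A : 'M[F]_#|T| := \matrix_(i, j) a (@enum_val T T i) (@enum_val T T j).
have AE u v : A (enum_rank u) (enum_rank v) = a u v by rewrite mxE !enum_rankK.
exists (fun u v => pinvmx A (enum_rank u) (enum_rank v)) => x y.
have /matrixP/(_ (enum_rank x) (enum_rank y)) := mulmxKpV (submx_refl A).
rewrite AE => <-; rewrite exchange_big mxE /=.
rewrite [RHS](reindex (@enum_rank T)) /=; last exact/onW_bij/enum_rank_bij.
apply: eq_bigr => v _; rewrite AE mxE big_distrl /=.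
rewrite [RHS](reindex (@enum_rank T)) /=; last exact/onW_bij/enum_rank_bij.
by apply: eq_bigr => u _; rewrite AE.
Qed.

Variables (gT : finGroupType) (H : {group gT}).
Implicit Types f g a b c : gT -> F.

Definition bi_inv f := forall s h h', h \in H -> h' \in H -> f (h * s * h')%g = f s.

(** The order of the factors matches [sharp]: for [u = (t * s)%g] the summand is
    [f (comp_perm s t) * g t^-1]. *)
Definition conv f g s := \sum_u f u * g (s * u^-1)%g.

(** Convolution as the matrix product of the kernels [f (y * x^-1)], through which matrix inverses
    enter. *)
Lemma convE f g x y : conv f g (y * x^-1)%g = \sum_u f (u * x^-1)%g * g (y * u^-1)%g.
Proof.
rewrite /conv (reindex_inj (mulIg x^-1)%g) /=; apply: eq_bigr => u _.
by rewrite invMg invgK mulgA mulgKV.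
Qed.

Lemma convA f g c : conv (conv f g) c = conv f (conv g c).
Proof.
apply/funext => s; rewrite /conv.
under eq_bigr do rewrite big_distrl /=.
rewrite exchange_big /=; apply: eq_bigr => u _.
rewrite big_distrr /= [RHS](reindex_inj (mulIg u^-1)%g) /=.
by apply: eq_bigr => v _; rewrite invMg invgK !mulgA mulgKV mulrA.
Qed.

Lemma convZl z f g s : conv (fun u => z * f u) g s = z * conv f g s.
Proof. by rewrite /conv big_distrr /=; apply: eq_bigr => u _; rewrite mulrA. Qed.

Lemma convZr z f g s : conv f (fun u => z * g u) s = z * conv f g s.
Proof. by rewrite /conv big_distrr /=; apply: eq_bigr => u _; rewrite mulrCA. Qed.

Lemma bi_inv_conv f g : bi_inv f -> bi_inv g -> bi_inv (conv f g).
Proof.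
move=> fH gH s h h' hH h'H; rewrite /conv (reindex_inj (mulIg h')) /=.
apply: eq_bigr => u _; congr (_ * _).
  by rewrite -[(u * h')%g]mul1g mulgA fH.
by rewrite invMg mulgA mulgK -mulgA -[(h * _)%g]mulg1 gH.
Qed.

(* Any matrix-theoretic generalized inverse of the convolution matrix of [a]
   becomes a bi-invariant convolution matrix after averaging over G x H x H. *)
Lemma ex_conv_inverse a : bi_inv a -> [pchar F] =i pred0 ->
  exists b, bi_inv b /\ conv (conv a b) a = a.
Proof.
move=> aH F0.
have [B aBa] := ex_generalized_inverse (fun x y => a (y * x^-1)%g).
(* A triple [p] stands for [(g, h, h')]. The common right factor [g] makes the average depend on
   [v * u^-1] only; [h] and [h'] make it bi-invariant. *)
pose P := [pred p : gT * gT * gT | (p.1.2 \in H) && (p.2 \in H)].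
pose N : F := #|P|%:R.
pose b s := N^-1 * \sum_(p | P p) B (p.1.2 * p.1.1)%g (p.2 * s * p.1.1)%g.
have N0 : N != 0.
  have /pcharf0P -> := F0; rewrite -lt0n; apply/card_gt0P.
  by exists (1, 1, 1)%g; rewrite inE /= !group1.
exists b; split=> [s h1 h2 h1H h2H | ]; last apply/funext => s.
  rewrite /b; congr (_ * _).
  rewrite (reindex (fun p => (h2^-1 * p.1.1, p.1.2 * h2, p.2 * h1^-1)%g)) /=; last first.
    by exists (fun p => (h2 * p.1.1, p.1.2 * h2^-1, p.2 * h1)%g) => [][[g h] h'] _ /=;
      rewrite mulKVg || rewrite mulKg; rewrite !mulgKV !mulgK.
  apply: eq_big => [][[g h] h'] /=.
    by rewrite !groupMr ?groupV.
  by move=> _; rewrite !mulgA !mulgK !mulgKV.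
have bE u v : b (v * u^-1)%g =
    N^-1 * \sum_(p | P p) B (p.1.2 * u * p.1.1)%g (p.2 * v * p.1.1)%g.
  rewrite /b; congr (_ * _).
  rewrite (reindex (fun p => (u * p.1.1, p.1.2, p.2)%g)) /=; last first.
    by exists (fun p => (u^-1 * p.1.1, p.1.2, p.2)%g) => [][[g h] h'] _ /=;
      rewrite ?mulKVg ?mulKg.
  by apply: eq_big => [][[g h] h'] //= _; rewrite !mulgA mulgKV.
rewrite -[s in LHS]mulg1 -[1%g in LHS]invg1 convE.
under eq_bigr do rewrite convE big_distrl /=.
rewrite exchange_big /=.
pose S p := \sum_u \sum_v
   a (u * 1^-1)%g * B (p.1.2 * u * p.1.1)%g (p.2 * v * p.1.1)%g * a (s * v^-1)%g.
transitivity (N^-1 * \sum_(p | P p) S p).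
  rewrite /S [X in _ = _ * X]exchange_big big_distrr /=; apply: eq_bigr => u _.
  rewrite [X in _ = _ * X]exchange_big big_distrr /=; apply: eq_bigr => v _.
  rewrite bE -big_distrl -big_distrr /=; ring.
rewrite (eq_bigr (fun=> a s)).
  by rewrite sumr_const -mulr_natl mulrA mulVf ?mul1r.
(* Every triple gives the value [a s]: in the variables [h * u * g] and [h' * v * g], bi-invariance
   of [a] turns [S] into the inverse identity at [g] and [s * g]. *)
move=> [[g h] h'] /andP[/= hH h'H]; rewrite /S /=.
have := aBa g (s * g)%g; rewrite mulgK => <-.
rewrite [RHS](reindex_inj (inj_comp (mulIg g) (mulgI h))) /=; apply: eq_bigr => u _.
rewrite [RHS](reindex_inj (inj_comp (mulIg g) (mulgI h'))) /=; apply: eq_bigr => v _.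
congr (_ * _ * _); first by rewrite mulgK invg1 mulg1 -[(h * u)%g]mulg1 aH.
by rewrite !invMg !mulgA mulgK -[(s * _)%g in RHS]mul1g aH ?groupV.
Qed.

(** If aba = a, then bab satisfies both equations. *)
Lemma ex_conv_pseudo_inverse a : bi_inv a -> [pchar F] =i pred0 ->
  exists b, [/\ bi_inv b, conv (conv a b) a = a & conv (conv b a) b = b].
Proof.
move=> aH F0; have [b [bH aba]] := ex_conv_inverse aH F0.
have abaf f : conv a (conv b (conv a f)) = conv a f by rewrite -[in RHS]aba !convA.
exists (conv (conv b a) b); split; first by do !apply: bi_inv_conv.
  by rewrite !convA abaf -convA.
by rewrite !convA !abaf.
Qed.

End PseudoInverse.

(** * From convolution on the group to the product [sharp] *)

Section WeingartenExists.
Variables (R : realType) (k : nat).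
Local Notation H := (hyperoctahedral_group k).
Implicit Types (f g : {ffun 'S_k.*2 -> R[i]}) (z : R[i]).

Lemma biinvariantP f : biinvariant f <-> bi_inv H f.
Proof.
split=> fH s h h' hH h'H; first by rewrite -[RHS](fH s h' h) // /comp_perm.
by rewrite /comp_perm fH.
Qed.

(** The summand of [sharp] is constant on the cosets represented by [pair_perms k], so
    [sum_pair_perms] applies. *)
Lemma sharpE f g : biinvariant f -> biinvariant g ->
  sharp f g = (fun s => #|H|%:R^-1 * conv f g s) :> (_ -> _).
Proof.
move=> /biinvariantP fH /biinvariantP gH; apply/funext => s; rewrite ffunE.
rewrite /conv [in RHS](reindex_inj (mulIg s)) /=.
rewrite [in RHS](eq_bigr (fun t => f (comp_perm s t) * g t^-1%g)); last first.
  by move=> t _; rewrite invMg mulKVg.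
rewrite sum_pair_perms => [|h t hH].
  by rewrite -[X in _ = _ * X]mulr_natl mulKf // pnatr_eq0 -lt0n cardG_gt0.
rewrite /comp_perm; congr (_ * _); first by rewrite -mulgA -[(h * _)%g]mulg1 fH.
by rewrite invMg -[(_ * h^-1)%g]mul1g mulgA gH ?groupV.
Qed.

Lemma biinvariant_sharp f g : biinvariant f -> biinvariant g -> biinvariant (sharp f g).
Proof.
move=> fH gH; apply/biinvariantP => s h h' hH h'H; rewrite (sharpE fH gH).
by rewrite (@bi_inv_conv _ _ H) //; exact/biinvariantP.
Qed.

Lemma ex_WgO z : biinvariant (zkappa k z) -> exists f, is_WgO z f.
Proof.
move=> aH; have /biinvariantP aH' := aH.
have [b [bH aba bab]] := ex_conv_pseudo_inverse aH' (@pchar_num _).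
pose c : R[i] := #|H|%:R.
have c0 : c != 0 by rewrite pnatr_eq0 -lt0n cardG_gt0.
(* The two [sharp] products in each equation bring a factor [c ^- 2], which this scaling
   compensates. *)
pose w : {ffun 'S_k.*2 -> R[i]} := [ffun s => c ^+ 2 * b s].
have wH : biinvariant w.
  by apply/biinvariantP => s h h' hH h'H; rewrite !ffunE bH.
have wE s : w s = c ^+ 2 * b s by rewrite ffunE.
have wE' : w = (fun s => c ^+ 2 * b s) :> (_ -> _) by apply/funext.
exists w; split=> //; apply/ffunP => s.
  rewrite (sharpE (biinvariant_sharp aH wH) aH) (sharpE aH wH) convZl wE'.
  rewrite (_ : conv _ (fun s => c ^+ 2 * b s) =
    fun s => c ^+ 2 * conv (zkappa k z) b s); last first.
    by apply/funext => t; rewrite convZr.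
  by rewrite (convZl (c ^+ 2) (conv (zkappa k z) b)) aba; field.
rewrite (sharpE (biinvariant_sharp wH aH) wH) (sharpE wH aH) convZl wE' convZr.
rewrite (_ : conv (fun s => c ^+ 2 * b s) (zkappa k z) =
  fun s => c ^+ 2 * conv b (zkappa k z) s); last first.
  by apply/funext => t; rewrite (convZl (c ^+ 2) b).
by rewrite (convZl (c ^+ 2) (conv b (zkappa k z))) bab; field.
Qed.

Lemma WgOP z : biinvariant (zkappa k z) -> is_WgO z (WgO k z).
Proof. by move=> /ex_WgO fW; exact: (@xgetPex _ [ffun=> 0] [set f | is_WgO z f]%classic fW). Qed.

(** The equation G Wg G = G for matrices indexed by the whole group; each of the two sums, extended
    from [pair_perms k], costs a factor [#|H|]. *)
Lemma gram_WgO z s t : biinvariant (zkappa k z) ->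
  \sum_u \sum_v zkappa k z (comp_perm s^-1 u)%g * WgO k z (comp_perm u^-1 v)%g
      * zkappa k z (comp_perm v^-1 t)%g =
  #|H|%:R ^+ 2 * zkappa k z (comp_perm s^-1 t)%g.
Proof.
move=> aH; have [wH awa _] := WgOP aH.
rewrite -[in RHS]awa (sharpE (biinvariant_sharp aH wH) aH) /comp_perm convE.
rewrite big_distrr exchange_big big_distrr /=; apply: eq_bigr => v _.
rewrite (sharpE aH wH) convE -big_distrl /=.
by field; rewrite pnatr_eq0 -lt0n cardG_gt0.
Qed.
End WeingartenExists.

(** * The first fundamental theorem *)

Section KernelSpan.
Variables (T I : finType).
Implicit Types (j : {ffun T -> I}) (r : {perm T}) (p : {perm I}).

(** A transposition corrects the value at each new element; injectivity keeps it from disturbing the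
    values already right. *)
Lemma perm_extension (s : seq I) (g : I -> I) : uniq s -> {in s &, injective g} ->
  exists p, {in s, p =1 g}.
Proof.
elim: s => [|x s IHs] /=; first by exists 1%g.
move=> /andP[xs us] gI; have [|p pg] := IHs us.
  by move=> a b sa sb; apply: gI; rewrite inE ?sa ?sb orbT.
exists (p * tperm (p x) (g x))%g => y; rewrite inE permM => /predU1P[->|ys].
  by rewrite tpermL.
have xy : x != y by apply: contraNneq xs => ->.
rewrite tpermD; first exact: pg; first by rewrite (inj_eq perm_inj).
by rewrite pg //; apply: contra_neq xy; apply: gI; rewrite inE ?eqxx ?ys ?orbT.
Qed.

(** What is finer is the partition of [T] into the fibres of [j0]; equivalently, [j] factors through
    [j0]. *)
Definition finer j0 j := [forall x, forall y, (j0 x == j0 y) ==> (j x == j y)].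

Lemma finerP j0 j : reflect (forall x y, j0 x = j0 y -> j x = j y) (finer j0 j).
Proof.
apply: (iffP forallP) => [jP x y j0xy | jP x].
  by have /forallP/(_ y)/implyP := jP x; rewrite j0xy eqxx => /(_ isT)/eqP.
by apply/forallP => y; apply/implyP => /eqP/jP ->.
Qed.

Definition perm_ffun p j : {ffun T -> I} := [ffun x => p (j x)].

Lemma finer_perm_ffun j0 j p : finer j0 (perm_ffun p j) = finer j0 j.
Proof.
apply/finerP/finerP => jP x y /jP; first by rewrite !ffunE => /perm_inj.
by rewrite !ffunE => ->.
Qed.

Lemma ffun_factor j0 j : finer j0 j -> exists g : I -> I, forall x, j x = g (j0 x).
Proof.
move=> /finerP jP.
exists (fun a => if [pick x | j0 x == a] is Some x then j x else a) => x.
by case: pickP => [y /eqP/jP -> // | /(_ x)]; rewrite eqxx.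
Qed.

Definition im_card j := #|[set j x | x in T]|.

Lemma finer_im_card j0 j : finer j0 j -> (im_card j <= im_card j0)%N.
Proof.
move=> /ffun_factor[g jE]; rewrite /im_card.
have -> : [set j x | x in T]%SET = g @: [set j0 x | x in T].
  by rewrite -finset.imset_comp; apply: eq_imset => x; rewrite /= jE.
exact: leq_imset_card.
Qed.

(** By counting, the map through which [j] factors is injective on the image of [j0], so it extends
    to a permutation. *)
Lemma finer_perm j0 j : finer j0 j -> (im_card j0 <= im_card j)%N ->
  exists p, j = perm_ffun p j0.
Proof.
move=> j0j rj; have [g jE] := ffun_factor j0j.
have gI : {in [set j0 x | x in T]%SET &, injective g}.
  apply/imset_injP; rewrite eqn_leq leq_imset_card /=.
  rewrite (leq_trans rj) // /im_card subset_leq_card //; apply/fintype.subsetP => a.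
  by move=> /imsetP[x _ ->]; rewrite jE !imset_f.
have [|p pg] := @perm_extension (enum [set j0 x | x in T]) g (enum_uniq _).
  by move=> a b; rewrite !mem_enum; apply: gI.
by exists p; apply/ffunP => x; rewrite ffunE pg ?jE // mem_enum imset_f.
Qed.

(* The permutation runs cyclically through each fibre of [j0]. *)
Lemma ex_fibre_cycle j0 :
  exists r, [forall j : {ffun T -> I}, [forall x, j (r x) == j x] == finer j0 j].
Proof.
pose fib x := enum [pred y | j0 y == j0 x].
have fibE x y : (y \in fib x) = (j0 y == j0 x) by rewrite mem_enum.
have fib_eq x y : j0 x = j0 y -> fib x = fib y.
  by move=> xy; apply: eq_enum => z; rewrite !inE xy.
pose nx x := next (fib x) x.
have nx_fib x : j0 (nx x) = j0 x by apply/eqP; rewrite -fibE mem_next fibE.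
have nx_inj : injective nx.
  move=> x y xy; have j0xy : j0 x = j0 y by rewrite -nx_fib xy nx_fib.
  apply: (can_inj (prev_next (enum_uniq _)) (_ : next (fib x) x = next (fib x) y)).
  by rewrite -/(nx x) xy (fib_eq _ _ j0xy).
exists (perm nx_inj); apply/forallP => j; apply/eqP; apply/forallP/finerP => [jP x y xy | jP x].
  have jnext z : j (next (fib x) z) = j z.
    have [zx|zx] := boolP (z \in fib x); last by rewrite next_nth (negPf zx).
    move: (zx); rewrite fibE => /eqP/fib_eq <-.
    by have := jP z; rewrite permE => /eqP.
  have := fconnect_cycle (cycle_next (enum_uniq _ : uniq (fib x))) (_ : x \in fib x) y.
  rewrite !fibE xy eqxx => /(_ isT) xcy.
  have clos : fingraph.closed (frel (next (fib x))) [pred z | j z == j x].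
    by move=> z _ /eqP <-; rewrite !inE jnext.
  by have := closed_connect clos xcy; rewrite !inE eqxx => /esym/eqP.
by apply/eqP/jP; rewrite permE nx_fib.
Qed.

Variable R : numFieldType.

(* Induction on the number of values of j: subtracting the right multiple of the
   indicator of [finer j0] for every j0 with m values kills f on functions with at
   least m values. *)
Lemma perm_invariant_span (f : {ffun T -> I} -> R) :
  (forall p j, f (perm_ffun p j) = f j) ->
  exists b : {perm T} -> R, forall j,
    f j = \sum_r b r * [forall x, j (r x) == j x]%:R.
Proof.
have [c cE] : exists c : {ffun T -> I} -> {perm T},
    forall j0 j, [forall x, j (c j0 x) == j x] = finer j0 j.
  exists (fun j0 => xchoose (ex_fibre_cycle j0)) => j0 j.
  by have /forallP/(_ j)/eqP := xchooseP (ex_fibre_cycle j0).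
suff span m : forall f, (forall p j, f (perm_ffun p j) = f j) ->
    (forall j, (m <= im_card j)%N -> f j = 0) ->
    exists b : {perm T} -> R, forall j,
    f j = \sum_r b r * [forall x, j (r x) == j x]%:R.
  (* No function has more than [#|I|] values, so the vanishing condition is empty here. *)
  move=> finv; apply: (span #|I|.+1) => // j; rewrite ltnNge.
  by rewrite max_card.
elim: m => [|m IHm] {}f finv f0.
  by exists (fun=> 0) => j; rewrite f0 // big1 // => r _; rewrite mul0r.
(* [N j0] counts the functions with the same fibres as [j0]; each of them occurs in the sum defining
   [g], with the same value of [f]. *)
pose N j0 : R := #|[pred j | finer j0 j && finer j j0]|%:R.
have N0 j0 : N j0 != 0.
  rewrite pnatr_eq0 -lt0n; apply/card_gt0P; exists j0.
  by rewrite inE andbb; apply/finerP.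
pose g j := f j - \sum_(j0 | im_card j0 == m) f j0 / N j0 * (finer j0 j)%:R.
have [|j mj|b bE] := IHm g.
- move=> p j; rewrite /g finv; congr (_ - _); apply: eq_bigr => j0 _.
  by rewrite finer_perm_ffun.
- rewrite /g; move: mj; rewrite leq_eqVlt => /predU1P[mj | mj]; last first.
    rewrite f0 // big1 ?subr0 // => j0 /eqP j0m.
    by case: (boolP (finer j0 j)) => [/finer_im_card|]; rewrite ?mulr0 // j0m leqNgt mj.
  apply/eqP; rewrite subr_eq0; apply/eqP.
  transitivity (\sum_(j0 | finer j j0 && finer j0 j) f j / N j).
    rewrite sumr_const -mulr_natr -/(N j) mulrVK // unitfE //.
  rewrite [RHS](bigID (fun j0 => finer j0 j)) /= [X in _ = _ + X]big1 ?addr0; last first.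
    by move=> j0 /andP[_ /negPf ->]; rewrite mulr0.
  apply: eq_big => [j0 | j0 /andP[jj0 j0j]].
    apply: andb_id2r => j0j; apply/idP/eqP => [jj0 | j0m].
      by apply/eqP; rewrite mj eqn_leq !finer_im_card.
    have [p ->] := finer_perm j0j (eq_leq (etrans j0m mj)).
    by apply/finerP => x y; rewrite !ffunE => /perm_inj.
  have [p jE] := finer_perm j0j (finer_im_card jj0).
  rewrite j0j mulr1; congr (_ / _); first by rewrite jE finv.
  congr (_%:R); apply: eq_card => j1; rewrite !inE.
  have tr a1 a2 a3 : finer a1 a2 -> finer a2 a3 -> finer a1 a3.
    by move=> /finerP h1 /finerP h2; apply/finerP => x y /h1/h2.
  apply/andP/andP => [][h1 h2]; split; first [exact: tr j0j h1 | exact: tr h2 jj0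
    | exact: tr jj0 h1 | exact: tr h2 j0j].
exists (fun r => b r + \sum_(j0 | im_card j0 == m) f j0 / N j0 * (r == c j0)%:R) => j.
under eq_bigr do rewrite mulrDl.
rewrite big_split /= -bE /g.
rewrite -[LHS](subrK (\sum_(j0 | im_card j0 == m) f j0 / N j0 * (finer j0 j)%:R)).
congr (_ + _); under [RHS]eq_bigr do rewrite big_distrl /=.
rewrite exchange_big /=; apply: eq_bigr => j0 _.
rewrite (bigD1 (c j0)) //= eqxx mulr1 cE big1 ?addr0 // => r /negPf ->.
by rewrite mulr0 mul0r.
Qed.

End KernelSpan.

(** * Polarization: recovering a tensor from its polynomial on symmetric matrices *)

Section Polarization.
Variables (R : rcfType) (k n : nat).
Local Notation X := 'I_k.*2.
Local Notation H := (hyperoctahedral k).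
Local Notation tensor := ({ffun X -> 'I_n} -> R).
Implicit Types (f : tensor) (j : {ffun X -> 'I_n}) (M U : 'M[R]_n).

(** Inclusion-exclusion: the sum factors over [i], where [e i = true] contributes 1, and
    [e i = false] contributes -1 if the fibre over [i] is empty and 0 otherwise. *)
Lemma sum_sign_surjective (A : comPzRingType) (T I : finType) (phi : T -> I) :
  \sum_(e : {ffun I -> bool})
     (\prod_i (if e i then 1 else - 1)) * \prod_x (e (phi x))%:R =
  [forall i, exists x, phi x == i]%:R :> A.
Proof.
pose w i (b : bool) : A := (if b then 1 else - 1) * \prod_(x | phi x == i) b%:R.
rewrite (eq_bigr (fun e : {ffun I -> bool} => \prod_i w i (e i))); last first.
  move=> e _; rewrite big_split /=; congr (_ * _).
  rewrite (partition_big phi predT) //=; apply: eq_bigr => i _.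
  by apply: eq_bigr => x /eqP ->.
rewrite -bigA_distr_bigA /=.
have wE i : \sum_b w i b = [exists x, phi x == i]%:R.
  rewrite big_bool /w /= mul1r big1 //; case: existsP => [[x xi]|nx].
    by rewrite (bigD1 x) //= mul0r mulr0 addr0.
  rewrite big_pred0 ?mulr1 ?addrN // => x.
  by apply/negP => xi; apply: nx; exists x.
case: (altP forallP) => [phis | ]; first by apply: big1 => i _; rewrite wE phis.
by rewrite negb_forall => /existsP[i /negPf ni]; rewrite (bigD1 i) //= wE ni mul0r.
Qed.

(** The homogeneous polynomial of degree [k] with coefficient tensor [f]. *)
Definition tensor_pairing f M := \sum_j f j * entry_monomial j M.

(* For j0, take A = sum_i e_i B_i with e in {0,1}^k and B_i the symmetrized matrix
   unit at (j0 (ptl i), j0 (ptr i)); the alternating sum over e keeps the terms using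
   every B_i exactly once, which are all multiples of f j0. *)
Lemma polarization f :
  (forall h j, h \in H -> f (ffun_comp h j) = f j) ->
  (forall M, M^T = M -> tensor_pairing f M = 0) -> forall j, f j = 0.
Proof.
move=> fH fsym j0.
pose B i : 'M[R]_n := \matrix_(a, b)
  (((a == j0 (ptl i)) && (b == j0 (ptr i)))%:R + ((b == j0 (ptl i)) && (a == j0 (ptr i)))%:R).
pose S (e : {ffun 'I_k -> bool}) : 'M[R]_n := \sum_i (e i)%:R *: B i.
have ST e : (S e)^T = S e.
  by apply/matrixP => a b; rewrite mxE !summxE; apply: eq_bigr => i _; rewrite !mxE addrC.
pose w (e : {ffun 'I_k -> bool}) : R := \prod_i (if e i then 1 else - 1).
pose Bprod (phi : {ffun 'I_k -> 'I_k}) j : R := \prod_r B (phi r) (j (ptl r)) (j (ptr r)).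
pose surj (phi : {ffun 'I_k -> 'I_k}) := [forall i, exists x, phi x == i].
have monoS e j : entry_monomial j (S e) =
    \sum_(phi : {ffun 'I_k -> 'I_k}) (\prod_r (e (phi r))%:R) * Bprod phi j.
  rewrite /entry_monomial.
  under eq_bigr do rewrite summxE.
  rewrite bigA_distr_bigA /=; apply: eq_bigr => phi _.
  by rewrite -big_split /=; apply: eq_bigr => r _; rewrite [LHS]mxE.
have sum0 : \sum_j \sum_(phi | surj phi) f j * Bprod phi j = 0.
  have : \sum_e w e * tensor_pairing f (S e) = 0.
    by rewrite big1 // => e _; rewrite fsym // mulr0.
  move=> sum0; rewrite -[RHS]sum0.
  under [RHS]eq_bigr do rewrite big_distrr /=.
  rewrite [RHS]exchange_big /=; apply: eq_bigr => j _.
  under [RHS]eq_bigr => e _.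
    rewrite monoS big_distrr big_distrr /=; over.
  rewrite [RHS]exchange_big /= [LHS]big_mkcond /=; apply: eq_bigr => phi _.
  transitivity ((surj phi)%:R * (f j * Bprod phi j)).
    by case: (surj phi); rewrite ?mul1r ?mul0r.
  rewrite -sum_sign_surjective big_distrl /=; apply: eq_bigr => e _.
  by rewrite -/(w e); ring.
have B0 i a b : 0 <= B i a b by rewrite mxE addr_ge0.
(* If no factor vanishes, each pair of [j] is a pair of [j0] up to order, matched bijectively by
   [phi]; so [j] and [j0] differ by an element of [H]. *)
have B_nz phi j : surj phi -> Bprod phi j != 0 -> f j = f j0.
  move=> phis; rewrite prodf_seq_neq0 => /allP Bnz.
  have phi_inj : injective phi.
    suff phiI : {in 'I_k &, injective phi} by move=> r r'; apply: phiI.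
    apply/image_injP/eqP/eq_card => i.
    by have /forallP/(_ i)/existsP[x /eqP <-] := phis; apply: fintype.image_f.
  pose c := [ffun r => ~~ ((j (ptl r) == j0 (ptl (phi r))) && (j (ptr r) == j0 (ptr (phi r))))].
  rewrite -(fH (pt_perm c (perm phi_inj)) j0) ?pt_perm_hyperoctahedral //; congr f.
  have jr r : j (ptl r) = j0 (pt (c r) (phi r)) /\ j (ptr r) = j0 (pt (~~ c r) (phi r)).
    have := Bnz r; rewrite mem_index_enum => /(_ isT) /=; rewrite ffunE mxE.
    case: andP => [[/eqP -> /eqP ->] // | _] /=; rewrite add0r.
    by case: andP => [[/eqP -> /eqP ->] // | _]; rewrite eqxx.
  by apply/ffunP; apply: pt_ind => r; rewrite ffunE permE ?pt_actl ?pt_actr permE;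
    have [] := jr r.
(* The vanishing sum equals [f j0 * Z], and [Z] is positive: its terms are nonnegative, and the one
   at [j0] and the identity is positive. *)
pose Z := \sum_j \sum_(phi | surj phi) Bprod phi j.
have Bp0 phi j : 0 <= Bprod phi j by apply: prodr_ge0.
have Z0 : 0 < Z.
  pose phi1 : {ffun 'I_k -> 'I_k} := [ffun i => i].
  rewrite /Z (bigD1 j0) //= ltr_pwDl //; last first.
    by apply: sumr_ge0 => j _; apply: sumr_ge0.
  rewrite (bigD1 phi1) /=; last first.
    by apply/forallP => i; apply/existsP; exists i; rewrite ffunE.
  rewrite ltr_pwDl ?sumr_ge0 //; apply: prodr_gt0 => r _.
  by rewrite ffunE mxE !eqxx ltr_pwDl.
have : f j0 * Z = 0.
  rewrite -sum0 /Z big_distrr /=; apply: eq_bigr => j _.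
  rewrite big_distrr /=; apply: eq_bigr => phi phis.
  by have [->|/(B_nz _ _ phis) ->] := eqVneq (Bprod phi j) 0; rewrite ?mulr0.
by move/eqP; rewrite mulf_eq0 (gt_eqF Z0) orbF => /eqP.
Qed.

End Polarization.

(** * Invariant tensors as combinations of the tensors [delta'] *)

Section FirstFundamentalTheorem.
Variables (R : rcfType) (k n : nat).
Local Notation X := 'I_k.*2.
Local Notation H := (hyperoctahedral_group k).
Local Notation tensor := ({ffun X -> 'I_n} -> R).
Implicit Types (f : tensor) (j : {ffun X -> 'I_n}) (M U : 'M[R]_n).

Definition hyperoctahedral_inv f :=
  forall h j, h \in H -> f (ffun_comp h j) = f j.

Definition orthogonal_inv f := forall U, U *m U^T = 1%:M ->
  forall j, f j = \sum_(j' : {ffun X -> 'I_n}) (\prod_x U (j x) (j' x)) * f j'.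

(** The sequences j_1, j_1, j_2, j_2, ..., outside which the monomials of a diagonal matrix
    vanish. *)
Definition dup_index (j : {ffun 'I_k -> 'I_n}) : {ffun X -> 'I_n} :=
  [ffun x => j (pt_half x)].

(** The pairing of an invariant tensor is unchanged by orthogonal conjugation, so [M] may be taken
    diagonal; only duplicated indices then contribute. *)
Lemma tensor_pairing_eq0 f : orthogonal_inv f ->
  (forall j : {ffun 'I_k -> 'I_n}, f (dup_index j) = 0) ->
  forall M, M^T = M -> tensor_pairing f M = 0.
Proof.
move=> fO f0 M /symmetric_diagonalization[U [D [UU ->]]].
rewrite /tensor_pairing.
under eq_bigr do rewrite entry_monomial_conj big_distrr /=.
rewrite exchange_big big1 //= => j' _.
transitivity (f j' * entry_monomial j' (diag_mx D)).
  have UU' : U^T *m U^T^T = 1%:M by rewrite trmxK; exact: mulmx1C.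
  rewrite [f j' in RHS](fO _ UU').
  rewrite big_distrl /=; apply: eq_bigr => j _; rewrite mulrA mulrC mulrA.
  rewrite [RHS]mulrAC [LHS]mulrC mulrA; congr (_ * _ * _).
  by apply: eq_bigr => x _; rewrite mxE.
rewrite entry_monomial_diag delta'E; case: (altP forallP) => [jlr | ]; last by rewrite mul0r mulr0.
rewrite (_ : j' = dup_index [ffun r => j' (ptl r)]) ?f0 ?mul0r //.
apply/ffunP; apply: pt_ind => r; rewrite !ffunE ?pt_half_ptl ?pt_half_ptr //.
by have := jlr r; rewrite !perm1 => /eqP ->.
Qed.

Lemma orthogonal_inv_perm f : orthogonal_inv f ->
  forall (p : 'S_n) j, f (perm_ffun p j) = f j.
Proof.
move=> fO p j; rewrite [RHS](fO (perm_mx p)); last by rewrite tr_perm_mx -perm_mxM mulgV perm_mx1.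
rewrite (bigD1 (perm_ffun p j)) //= [X in _ + X]big1 => [|j' j'p].
  by rewrite addr0 big1 ?mul1r // => x _; rewrite !mxE ffunE eqxx.
have [x jx] : exists x, j' x != p (j x).
  apply/existsP; apply: contraR j'p; rewrite negb_exists => /forallP j'p.
  by apply/eqP/ffunP => x; rewrite ffunE; apply/eqP; have := j'p x; rewrite negbK.
by rewrite (bigD1 x) //= !mxE eq_sym (negPf jx) !mul0r.
Qed.

(** Left points are fixed and right points moved by [r], so [ptl x] gets paired with [ptr (r x)]. *)
Lemma delta'_dup_index (r : 'S_k) : exists s : 'S_k.*2, forall j : {ffun 'I_k -> 'I_n},
  delta' s (dup_index j) = [forall x, j (r x) == j x].
Proof.
pose g (x : X) := if odd x then ptr (r (pt_half x)) else x.
have gl i : g (ptl i) = ptl i by rewrite /g /= odd_double.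
have gr i : g (ptr i) = ptr (r i) by rewrite /g pt_half_ptr /= odd_double.
have gI : injective g.
  apply: pt_ind => i; apply: pt_ind => i'; rewrite ?gl ?gr //.
  - by move/eqP; rewrite (negPf (ptl_neq_ptr _ _)).
  - by move/esym/eqP; rewrite (negPf (ptl_neq_ptr _ _)).
  - by move=> /ptr_inj/perm_inj ->.
exists (perm gI) => j; rewrite delta'E; congr nat_of_bool; apply: eq_forallb => i.
by rewrite !permE gl gr !ffunE pt_half_ptl pt_half_ptr eq_sym.
Qed.

(** On duplicated indices [f] is invariant under ['S_n], hence a combination of fibre conditions,
    each the restriction of some [delta' s]. The average over [H] of the same combination of tensors
    is invariant and agrees with [f] on duplicated indices, hence everywhere. *)
Theorem first_fundamental_theorem f : hyperoctahedral_inv f -> orthogonal_inv f ->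
  exists c : 'S_k.*2 -> R, forall j, f j = \sum_s c s * (delta' s j)%:R.
Proof.
move=> fH fO.
have [b bE] : exists b : 'S_k -> R, forall j : {ffun 'I_k -> 'I_n},
    f (dup_index j) = \sum_r b r * [forall x, j (r x) == j x]%:R.
  apply: perm_invariant_span => p j; rewrite -[RHS](orthogonal_inv_perm fO p).
  by congr f; apply/ffunP => x; rewrite !ffunE.
have [s sE] : exists s : 'S_k -> 'S_k.*2, forall r (j : {ffun 'I_k -> 'I_n}),
    delta' (s r) (dup_index j) = [forall x, j (r x) == j x].
  by have [s sE] := choice delta'_dup_index; exists s.
pose avg j := \sum_(h in H) \sum_r b r * (delta' (s r) (ffun_comp h j))%:R.
pose m : R := #|H|%:R.
have m0 : m != 0 by rewrite pnatr_eq0 -lt0n cardG_gt0.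
pose g j := f j - m^-1 * avg j.
have avgH : hyperoctahedral_inv avg.
  move=> h j hH; rewrite /avg [RHS](reindex_inj (mulIg h)) /=.
  apply: eq_big => [h'|h' _]; first by rewrite groupMr.
  suff -> : ffun_comp h' (ffun_comp h j) = ffun_comp (h' * h)%g j by [].
  by apply/ffunP => x; rewrite !ffunE permM.
have gH : hyperoctahedral_inv g by move=> h j hH; rewrite /g fH ?avgH.
have gO : orthogonal_inv g.
  move=> U UU j; rewrite /g.
  under eq_bigr do rewrite mulrBr.
  rewrite sumrB -(fO U UU); congr (_ - _).
  under [RHS]eq_bigr do rewrite mulrCA.
  rewrite -big_distrr /=; congr (_ * _); rewrite /avg.
  under [RHS]eq_bigr do rewrite big_distrr /=.
  rewrite [RHS]exchange_big /=; apply: eq_bigr => h hH.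
  under [RHS]eq_bigr do rewrite big_distrr /=.
  rewrite [RHS]exchange_big /=; apply: eq_bigr => r _.
  under [RHS]eq_bigr do rewrite mulrCA delta'_ffun_comp.
  rewrite -big_distrr /= delta'_ffun_comp; congr (_ * _).
  rewrite -(@delta'_orthogonal _ _ _ U^T) ?trmxK //.
  apply: eq_bigr => j' _; congr (_ * _); apply: eq_bigr => x _; by rewrite mxE.
have g0 (j : {ffun 'I_k -> 'I_n}) : g (dup_index j) = 0.
  (* An element of [H] maps pairs to pairs, so duplicated indices stay duplicated and every [h]
     contributes [f (dup_index j)]. *)
  rewrite /g /avg; under eq_bigr => h hH.
    have [j' j'E] : exists j' : {ffun 'I_k -> 'I_n}, ffun_comp h (dup_index j) = dup_index j'.
      exists [ffun r => j (pt_half (h (ptl r)))].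
      apply/ffunP; apply: pt_ind => r; rewrite !ffunE ?pt_half_ptl ?pt_half_ptr //.
      by rewrite -pt_swapl (hyperoctahedralP _ hH) /pt_swap;
        case: (~~ _); rewrite ?pt_half_ptl ?pt_half_ptr.
    under eq_bigr do rewrite j'E sE.
    rewrite -bE -j'E fH //; over.
  by rewrite sumr_const -[f _ *+ _]mulr_natl mulKf // subrr.
have gz := polarization gH (tensor_pairing_eq0 gO g0).
(* Composing [j] with [h] turns [delta' (s r)] into [delta' (s r * h)]; the coefficient at [t]
   collects these terms. *)
exists (fun t => m^-1 * \sum_(h in H) \sum_r b r * (t == (s r * h)%g)%:R) => j.
have /eqP := gz j; rewrite /g subr_eq0 => /eqP ->.
under [RHS]eq_bigr do rewrite -mulrA.
rewrite -big_distrr /=; congr (_ * _); rewrite /avg.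
under [RHS]eq_bigr do rewrite big_distrl /=.
rewrite [RHS]exchange_big /=; apply: eq_bigr => h hH.
under [RHS]eq_bigr do rewrite big_distrl /=.
rewrite [RHS]exchange_big /=; apply: eq_bigr => r _.
rewrite (bigD1 (s r * h)%g) //= eqxx mulr1 delta'_ffun_comp big1 ?addr0 // => t /negPf ->.
by rewrite mulr0 mul0r.
Qed.

End FirstFundamentalTheorem.

(** * Moments *)

(** [h] permutes and flips pairs; commutativity absorbs the former and the symmetry of [M] the
    latter. *)
Lemma entry_monomial_hyperoctahedral (A : comPzRingType) (k n : nat) (h : 'S_k.*2)
    (j : {ffun 'I_k.*2 -> 'I_n}) (M : 'M[A]_n) : h \in hyperoctahedral k -> M^T = M ->
  entry_monomial (ffun_comp h j) M = entry_monomial j M.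
Proof.
move=> /hyperoctahedralP hH MT.
pose m (x : 'I_k.*2) := M (j x) (j (pt_swap x)).
have m_swap x : m (pt_swap x) = m x by rewrite /m pt_swapK -[in RHS]MT mxE.
have m_half x : m (ptl (pt_half x)) = m x.
  by elim/pt_ind: x => r; rewrite ?pt_half_ptl // pt_half_ptr -[in LHS]m_swap pt_swapl.
have r_inj : injective (fun r => pt_half (h (ptl r))).
  move=> r r' hrr; suff: h (ptl r) = h (ptl r') \/ h (ptl r) = h (ptr r').
    case=> /perm_inj => [/ptl_inj // | /eqP]; by rewrite (negPf (ptl_neq_ptr _ _)).
  move: hrr; rewrite -[ptr r']pt_swapl hH.
  elim/pt_ind: (h (ptl r)) => a; elim/pt_ind: (h (ptl r')) => b;
    rewrite ?pt_half_ptl ?pt_half_ptr ?pt_swapl ?pt_swapr => ->; by [left | right].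
rewrite /entry_monomial [RHS](reindex_inj r_inj); apply: eq_bigr => r _.
rewrite !ffunE -[ptr r]pt_swapl hH -[LHS]/(m _) -m_half /m pt_swapl.
by [].
Qed.

Section Expectation.
Context (R : realType) (d : measure_display) (T : measurableType d) (P : probability T R).

(** Each expectation is the integral of the identity against the law on [R]. *)
Lemma eq_expectation_law (X Y : T -> R) :
  P.-integrable [set: T] (EFin \o X) -> P.-integrable [set: T] (EFin \o Y) ->
  (forall B : set R, measurable B -> P (X @^-1` B)%classic = P (Y @^-1` B)%classic) ->
  ('E_P[X] = 'E_P[Y])%E.
Proof.
move=> iX iY XY; rewrite expectation.unlock.
have mX : measurable_fun [set: T] X by apply/measurable_EFinP/(measurable_int _ iX).
have mY : measurable_fun [set: T] Y by apply/measurable_EFinP/(measurable_int _ iY).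
have push (Z : T -> R) (mZ : measurable_fun [set: T] Z) (iZ : P.-integrable [set: T] (EFin \o Z)) :
    (\int[P]_w (Z w)%:E = \int[pushforward P Z]_y y%:E)%E.
  by rewrite (integral_pushforward mZ) ?preimage_setT //; exact/measurable_EFinP.
by rewrite (push X) // (push Y) //; apply: eq_measure_integral => B mB _; exact: XY.
Qed.

Variable n : nat.

Lemma measurable_coord (a b : 'I_n) :
  measurable_fun [set: borel_mx R n] (fun M : borel_mx R n => (M : 'M[R]_n) a b).
Proof.
apply: (measurability _ (RGenOpens.measurableE R)) => _ [_ [x [y ->]] <-].
rewrite setTI; apply: sub_sigma_algebra.
have /continuousP := @coord_continuous R n n a b; apply; exact: interval_open.
Qed.

Lemma measurable_entry_monomial (k : nat) (j : 'I_k.*2 -> 'I_n) :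
  measurable_fun [set: borel_mx R n] (fun M : borel_mx R n => entry_monomial j (M : 'M[R]_n)).
Proof. by apply: measurable_prod => r _; exact: measurable_coord. Qed.

End Expectation.

Section Moments.
Context (R : realType) (n k : nat) (d : measure_display) (T : measurableType d)
  (P : probability T R) (W : {RV P >-> borel_mx R n}).
Hypothesis W_sym : forall t : T, (W t : 'M[R]_n)^T = W t.
Hypothesis W_inv : orthogonally_invariant P W.
Hypothesis W_int : forall j : 'I_k.*2 -> 'I_n,
  P.-integrable [set: T] (fun t => (entry_monomial j (W t))%:E).
Implicit Types (j : {ffun 'I_k.*2 -> 'I_n}).

Definition moment j : R := fine 'E_P[fun t => entry_monomial j (W t)].

Lemma integrable_sum_monomial (c : {ffun 'I_k.*2 -> 'I_n} -> R) :
  P.-integrable [set: T] (fun t => (\sum_j c j * entry_monomial j (W t))%:E).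
Proof.
under eq_fun do rewrite -sumEFin.
apply: integrable_sum => // j _; under eq_fun do rewrite EFinM.
exact: integrableZl.
Qed.

Lemma expectation_sum_monomial (c : {ffun 'I_k.*2 -> 'I_n} -> R) :
  ('E_P[fun t => (\sum_j c j * entry_monomial j (W t))%R])%E = (\sum_j c j * moment j)%:E.
Proof.
rewrite /moment expectation.unlock.
under eq_integral do rewrite -sumEFin.
rewrite integral_sum //; last first.
  move=> j; under eq_fun do rewrite EFinM.
  exact: integrableZl.
rewrite -sumEFin; apply: eq_bigr => j _.
under eq_integral do rewrite EFinM.
rewrite integralZl // EFinM fineK //.
exact: integrable_fin_num.
Qed.

(** Multilinear expansion makes the sum the expectation of the monomial at [U *m W t *m U^T], which
    has the law of [W]. *)
Lemma moment_orthogonal_inv : orthogonal_inv moment.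
Proof.
move=> U UU j.
have conjE t : entry_monomial j (U *m W t *m U^T) =
    \sum_(j' : {ffun 'I_k.*2 -> 'I_n}) (\prod_x U (j x) (j' x)) * entry_monomial j' (W t).
  exact: entry_monomial_conj.
apply: EFin_inj; rewrite -expectation_sum_monomial.
rewrite (_ : 'E_P[_]%E = 'E_P[fun t => entry_monomial j (U *m W t *m U^T)%R]%E); last first.
  by congr expectation; apply/funext => t; rewrite conjE.
rewrite /moment fineK; last by rewrite expectation.unlock; exact: integrable_fin_num.
apply: eq_expectation_law; first exact: W_int.
  rewrite (_ : _ \o _ = fun t => (\sum_(j' : {ffun 'I_k.*2 -> 'I_n})
      (\prod_x U (j x) (j' x)) * entry_monomial j' (W t))%:E).
    exact: integrable_sum_monomial.
  by apply/funext => t; rewrite /= conjE.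
move=> B mB; symmetry.
apply: (W_inv UU (B := ((fun M : borel_mx R n => entry_monomial j (M : 'M[R]_n)) @^-1` B)%classic)).
by rewrite -[X in measurable X]setTI; exact: measurable_entry_monomial.
Qed.

Lemma moment_hyperoctahedral_inv : hyperoctahedral_inv moment.
Proof.
move=> h j hH; rewrite /moment; congr (fine (expectation _ _)); apply/funext => t.
exact: entry_monomial_hyperoctahedral.
Qed.

Lemma expectation_Tr' (a0 : 'I_n) (s : 'S_k.*2) :
  'E_P[fun t => Tr' s (W t)]%E = (\sum_(j : {ffun 'I_k.*2 -> 'I_n}) (delta' s j)%:R * moment j)%:E.
Proof.
rewrite -expectation_sum_monomial; congr expectation; apply/funext => t.
by rewrite (Tr'_symmetric a0).
Qed.

End Moments.

(** * The Gram matrix of the tensors [delta'] *)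

Section GramKernel.
Variables (R : realType) (k n : nat).
Hypothesis a0 : 'I_n.
Local Notation X := 'I_k.*2.
Local Notation H := (hyperoctahedral_group k).
Local Notation gram s t := (zkappa k (n%:R : R[i]) (comp_perm s^-1%g t)).

Lemma gramE (s t : 'S_k.*2) :
  gram s t = \sum_(j : {ffun X -> 'I_n}) (delta' s j)%:R * (delta' t j)%:R.
Proof. by rewrite ffunE (gram_kappa' _ a0). Qed.

(** The function is the row of the Gram matrix at 1. A left factor in [H] does not change [delta'];
    a right factor is moved onto [delta' 1] by reindexing [j]. *)
Lemma biinvariant_zkappa : biinvariant (zkappa k (n%:R : R[i])).
Proof.
have gram1 s : zkappa k (n%:R : R[i]) s = gram 1%g s by rewrite /comp_perm invg1 mulg1.
apply/biinvariantP => s h h' hH h'H.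
rewrite gram1 [RHS]gram1 !gramE.
rewrite [LHS](reindex (ffun_comp h'^-1)) /=; last exact/onW_bij/ffun_comp_bij.
apply: eq_bigr => j _; rewrite !delta'_ffun_comp mulgK mul1g delta'_mulHl //.
by rewrite -(delta'_mulHl 1%g _ (groupVr h'H)) mulg1.
Qed.

(** The Hermitian form v^* G v is the sum of the |y j|^2, so every [y j] vanishes. *)
Lemma gram_kernel (v : 'S_k.*2 -> R[i]) : (forall r, \sum_s gram r s * v s = 0) ->
  forall j : {ffun X -> 'I_n}, \sum_s (delta' s j)%:R * v s = 0.
Proof.
move=> v0; pose y (j : {ffun X -> 'I_n}) := \sum_s (delta' s j)%:R * v s.
suff y2 : \sum_j y j * (y j)^* = 0.
  move=> j; apply/eqP; rewrite -[_ == 0]mul_conjC_eq0.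
  apply/eqP; apply: (psumr_eq0P _ y2) => // j' _; exact: mul_conjC_ge0.
transitivity (\sum_r (v r)^* * \sum_s gram r s * v s); last first.
  by rewrite big1 // => r _; rewrite v0 mulr0.
rewrite (eq_bigr (fun j : {ffun X -> 'I_n} => \sum_r (v r)^* * ((delta' r j)%:R * y j))) => [|j _].
  rewrite exchange_big /=; apply: eq_bigr => r _; rewrite -big_distrr /=; congr (_ * _).
  under eq_bigr do rewrite /y big_distrr /=.
  rewrite exchange_big /=; apply: eq_bigr => s _; rewrite gramE big_distrl /=.
  by apply: eq_bigr => j _; rewrite mulrA.
rewrite /y rmorph_sum big_distrr /=; apply: eq_bigr => r _.
by rewrite rmorphM /= conjC_nat; ring.
Qed.

End GramKernel.

Theorem theorem3p3 (R : realType) (n k : nat) (hn : (1 <= n)%N) (hk : (1 <= k)%N)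
    (d : measure_display) (T : measurableType d) (P : probability T R)
    (W : {RV P >-> borel_mx R n})
    (W_sym : forall t : T, (W t : 'M[R]_n)^T = W t)
    (W_inv : orthogonally_invariant P W)
    (W_int : forall j : 'I_k.*2 -> 'I_n,
      P.-integrable [set: T] (fun t => (entry_monomial j (W t))%:E))
    (i : 'I_k.*2 -> 'I_n) :
  (fine 'E_P[fun t => entry_monomial i (W t)])%:C%C =
  \sum_(s in pair_perms k) \sum_(t in pair_perms k)
    (delta' s i)%:R * WgO k (n%:R : R[i]) (comp_perm s^-1%g t)
    * (fine 'E_P[fun x => Tr' t (W x)])%:C%C.
Proof.
pose a0 := Ordinal hn; pose H := hyperoctahedral_group k.
pose z : R[i] := n%:R; pose wg := WgO k z.
pose m : R[i] := #|H|%:R.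
have m0 : m != 0 by rewrite pnatr_eq0 -lt0n cardG_gt0.
pose j : {ffun 'I_k.*2 -> 'I_n} := [ffun x => i x].
have zH : biinvariant (zkappa k z) := @biinvariant_zkappa R k n a0.
have /biinvariantP wgH : biinvariant wg by have [] := WgOP zH.
have [c cE] := first_fundamental_theorem (moment_hyperoctahedral_inv W_sym)
  (moment_orthogonal_inv W_inv W_int).
pose tr (t : 'S_k.*2) := fine 'E_P[fun x => Tr' t (W x)]%E.
have trS t : tr t = \sum_(j' : {ffun 'I_k.*2 -> 'I_n}) (delta' t j')%:R * moment W j'.
  by rewrite /tr (expectation_Tr' W_sym W_int a0).
have trE t : (tr t)%:C%C = \sum_u zkappa k z (comp_perm t^-1%g u) * (c u)%:C%C.
  rewrite trS rmorph_sum /=.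
  under [RHS]eq_bigr do rewrite (gramE _ a0) big_distrl /=.
  rewrite [RHS]exchange_big /=; apply: eq_bigr => j' _.
  rewrite cE rmorphM rmorph_sum rmorph_nat big_distrr /=; apply: eq_bigr => u _.
  by rewrite rmorphM rmorph_nat mulrA mulrAC.
have trH h t : h \in H -> tr (h * t)%g = tr t.
  by move=> hH; rewrite !trS; apply: eq_bigr => j' _; rewrite delta'_mulHl.
have iE s : delta' s i = delta' s j by apply: eq_bigr => r _; rewrite !ffunE.
transitivity (\sum_s (delta' s j)%:R * (c s)%:C%C).
  transitivity (moment W j)%:C%C.
    congr (_%:C%C); congr (fine (expectation _ _)); apply/funext => t.
    by apply: eq_bigr => r _; rewrite !ffunE.
  rewrite cE rmorph_sum; apply: eq_bigr => s _.
  by rewrite rmorphM rmorph_nat mulrC.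
pose q s t := (delta' s j)%:R * wg (comp_perm s^-1 t)%g * (tr t)%:C%C.
(* Both sums over pair partitions become sums over the group, each at the cost of a factor
   [m^-1]. *)
have sumM (f : 'S_k.*2 -> R[i]) : (forall h s, h \in H -> f (h * s)%g = f s) ->
    \sum_(s in pair_perms k) f s = m^-1 * \sum_s f s.
  by move=> fH; rewrite sum_pair_perms // -[X in _ * X]mulr_natl mulKf.
have qH s h t : h \in H -> q s (h * t)%g = q s t.
  move=> hH; rewrite /q (trH h t hH) /comp_perm -mulgA -[(h * _)%g]mulg1.
  by rewrite (wgH _ _ _ hH (group1 _)).
rewrite [RHS](eq_bigr (fun s => \sum_(t in pair_perms k) q s t)); last first.
  by move=> s _; rewrite /q; under eq_bigr do rewrite iE.
rewrite (sumM (fun s => \sum_(t in pair_perms k) q s t)) => [|h s hH]; last first.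
  rewrite /=; apply: eq_bigr => t _; rewrite /q delta'_mulHl // /comp_perm invMg.
  by rewrite mulgA -[(t * s^-1)%g]mul1g wgH ?groupV ?mul1g.
rewrite [X in _ = _ * X](eq_bigr (fun s => m^-1 * \sum_t q s t)); last first.
  by move=> s _; exact: sumM (qH s).
rewrite -big_distrr /=.
pose x s := \sum_t wg (comp_perm s^-1 t)%g * (tr t)%:C%C.
(* The factor [m ^+ 2] is that of [gram_WgO], which puts [v] in the kernel of the Gram matrix. *)
pose v s := x s - m ^+ 2 * (c s)%:C%C.
have sumv (b : 'S_k.*2 -> R[i]) :
    \sum_s b s * v s = \sum_s b s * x s - \sum_s b s * (m ^+ 2 * (c s)%:C%C).
  by rewrite -sumrB; apply: eq_bigr => s _; exact: mulrBr.
have v0 : \sum_s (delta' s j)%:R * v s = 0.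
  apply: (@gram_kernel _ _ _ a0) => r.
  rewrite sumv; apply/eqP; rewrite subr_eq0; apply/eqP.
  rewrite /x; under eq_bigr => s _.
    rewrite big_distrr /=; under eq_bigr => t _.
      rewrite trE big_distrr big_distrr /=; over.
    rewrite exchange_big /=; over.
  rewrite exchange_big /=; apply: eq_bigr => u _.
  rewrite mulrCA mulrA -(gram_WgO r u zH) big_distrl /=; apply: eq_bigr => s _.
  by rewrite big_distrl /=; apply: eq_bigr => t _; rewrite !mulrA.
move/eqP: v0; rewrite sumv subr_eq0 => /eqP v0.
transitivity (m ^- 2 * \sum_s (delta' s j)%:R * (m ^+ 2 * (c s)%:C%C)).
  rewrite big_distrr /=; apply: eq_bigr => s _.
  by field.
rewrite -v0 /x -exprVn expr2 -mulrA; congr (_ * (_ * _)); apply: eq_bigr => s _.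
by rewrite big_distrr /=; apply: eq_bigr => t _; rewrite /q mulrA.
Qed.
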